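(* Let $\Omega$ be a connected open subset of $\mathbb C$, let $n$ be a (finite) positive integer, and let $T$ be a bounded linear operator on a complex separable Hilbert space $\mathcal H$ belonging to the Cowen–Douglas class $B_n(\Omega)$. Then $T$ is circular if and only if $T$ is strongly circular.
   Context: Let $\mathbb T=\{\lambda\in\mathbb C:|\lambda|=1\}$. A bounded linear operator $T$ on a complex Hilbert space $\mathcal H$ is circular if for each $\lambda\in\mathbb T$ there exists a unitary operator $U_\lambda$ on $\mathcal H$ such that $U_\lambda T=\lambda T U_\lambda$. It is strongly circular if the unitaries $U_\lambda$ can be chosen so that $\lambda\mapsto U_\lambda$ is a strongly continuous unitary representation of the group $\mathbb T$ on $\mathcal H$. For a connected open set $\Omega\subseteq\mathbb C$ and a finite positive integer $n$, a bounded linear operator $T$ on a complex separable Hilbert space $\mathcal H$ belongs to the Cowen–Douglas class $B_n(\Omega)$ if: (i) $\Omega\subseteq\sigma(T)$, the spectrum of $T$; (ii) $\operatorname{ran}(T-w)=\mathcal H$ for all $w\in\Omega$; (iii) $\bigvee_{w\in\Omega}\ker(T-w)=\mathcal H$, where $\bigvee$ denotes the closed linear span; (iv) $\dim\ker(T-w)=n$ for all $w\in\Omega$. *)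

(* Defs.v *)
From HB Require Import structures.
From mathcomp Require Import all_boot all_order all_algebra.
From mathcomp Require Import all_classical all_reals all_analysis.
From mathcomp Require Import complex.

Set Implicit Arguments.
Unset Strict Implicit.
Unset Printing Implicit Defensive.

Import Order.TTheory GRing.Theory Num.Theory.
Import numFieldNormedType.Exports.

Local Open Scope classical_set_scope.
Local Open Scope ring_scope.

(* Everything is stated over a numClosedFieldType [C], because the topology of
   a numeric field is attached to these structures and not to the concrete type
   [R[i]]; the field of complex numbers is obtained for [C := R[i]]. *)

(* The inner product is linear in its first argument and conjugate-linear in
   the second.  Norms take their (nonnegative real) values in [C]. *)
HB.mixin Record CompleteNormedModule_isHilbert (C : numClosedFieldType)
    (H : Type) of CompleteNormedModule C H := {
  inner : {dot H for (@Num.conj C)} ;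
  norm_inner : forall x : H, `|x| = sqrtC (inner x x)
}.

#[short(type="hilbertType")]
HB.structure Definition Hilbert (C : numClosedFieldType) :=
  {H of CompleteNormedModule_isHilbert C H & CompleteNormedModule C H}.

Definition separable_space (X : topologicalType) :=
  exists2 D : set X, countable D & dense D.

Definition connected_open (C : numClosedFieldType) (Omega : set C) :=
  connected Omega /\ open Omega.

Definition unit_circle (C : numClosedFieldType) : set C := [set l | `|l| = 1].
Arguments unit_circle {C}.

Section Operators.
Variables (C : numClosedFieldType) (H : hilbertType C).
Implicit Types T U : {linear H -> H}.

Definition bounded_operator T := exists M : C, forall x, `|T x| <= M * `|x|.

Definition unitary U :=
  bijective U /\ forall x y, inner (U x) (U y) = inner x y.

Definition circular T :=
  forall l : C, unit_circle l ->
    exists2 U : {linear H -> H}, unitary U & forall x, U (T x) = l *: T (U x).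

(* [U] is a total function on [C], but only its values on the unit circle
   matter. *)
Definition strongly_continuous_unitary_rep (U : C -> {linear H -> H}) :=
  [/\ forall l, unit_circle l -> unitary (U l),
      forall l m, unit_circle l -> unit_circle m ->
        forall x, U (l * m) x = U l (U m x) &
      forall x, {within unit_circle, continuous (fun l : C => U l x)}].

Definition strongly_circular T :=
  exists2 U : C -> {linear H -> H}, strongly_continuous_unitary_rep U &
    forall l, unit_circle l -> forall x, U l (T x) = l *: T (U l x).

Definition sub_scalar T (w : C) (x : H) : H := T x - w *: x.

Definition spectrum T : set C :=
  [set w | ~ exists S : {linear H -> H},
     [/\ bounded_operator S, cancel (sub_scalar T w) S
       & cancel S (sub_scalar T w)]].

Definition ker_sub_scalar T (w : C) : set H := [set x | sub_scalar T w x = 0].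

Definition linear_span (A : set H) : set H :=
  [set x | exists (k : nat) (a : 'I_k -> C) (v : 'I_k -> H),
     (forall i, A (v i)) /\ x = \sum_i a i *: v i].

Definition closed_linear_span (A : set H) : set H := closure (linear_span A).

(* The linear subspace [A] has a basis with [n] elements. *)
Definition has_dimension (A : set H) (n : nat) :=
  exists e : 'I_n -> H,
    (forall a : 'I_n -> C, \sum_i a i *: e i = 0 -> forall i, a i = 0) /\
    A = [set x | exists a : 'I_n -> C, x = \sum_i a i *: e i].

Definition cowen_douglas (Omega : set C) (n : nat) T :=
  [/\ Omega `<=` spectrum T,
      forall w, Omega w -> range (sub_scalar T w) = setT,
      closed_linear_span (\bigcup_(w in Omega) ker_sub_scalar T w) = setT &
      forall w, Omega w -> has_dimension (ker_sub_scalar T w) n].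

End Operators.

(* Main.v *)
Require Import Defs.
From HB Require Import structures.
From mathcomp Require Import all_boot all_order all_algebra.
From mathcomp Require Import all_classical all_reals all_analysis.
From mathcomp Require Import complex.
From mathcomp Require Import ring lra.

Set Implicit Arguments.
Unset Strict Implicit.
Unset Printing Implicit Defensive.

Import Order.TTheory GRing.Theory Num.Theory.
Import numFieldNormedType.Exports.

Local Open Scope classical_set_scope.
Local Open Scope ring_scope.

(* Proof.  Let E_w = ker (T - w).  Since T - w is onto, it is bounded below on
   the orthogonal complement of E_w, so E_w' is close to E_w for w' near w.
   Connectedness of Omega then shows that a projection commuting with T and
   vanishing on one E_w is 0; as dim E_w = n, the identity is a sum of at most n
   irreducible projections p_i commuting with T.

   If U implements the rotation by l, then U p_i U^-1 is equivalent, by Schur's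
   lemma, to one of the p_j.  There are finitely many classes and the circle
   group is divisible, so each irreducible piece is itself circular.

   On an irreducible piece the implementing unitary of a rotation is unique up
   to a unimodular scalar.  Let V lift the rotation of order m, normalized so
   that V^m = 1.  By Parseval for the finite Fourier decomposition under V, one
   can choose an m-th root of unity u such that u V fixes a vector g_m of the
   unit ball with a component bounded below, uniformly in m, in the finite
   dimensional space E_w.  A weak ultralimit g of the g_m is nonzero, and the
   lifts are relatively compact in the strong topology, so every rotation has a
   unique lift fixing g.  By uniqueness these lifts form a representation, and
   by compactness it is strongly continuous. *)

(** * Real-valued norms and convergence along filters *)

(** Lifts chosen independently for different rotations compose only up to phases, and these phases
    need not vary continuously. Demanding that every lift fix one common vector removes the phase;
    the group law and continuity then both follow from uniqueness. No eigenvector of a given lift is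
    visible in advance, which is why rotations of finite order come first: there, finite sums give
    the spectral decomposition. The price is a limit in the order, and the danger is that the chosen
    eigenvectors tend weakly to 0. The lower bound that excludes this is bought by the surjectivity
    of [T - w] and the finite dimension of its kernel: lifts of small rotations hardly move
    [ker (T - w0)] away from itself. Limits are taken along ultrafilters, where every bounded family
    of scalars converges, instead of along successive subsequences. Auxiliary operators are plain
    functions paired with an adjoint, since [adj A B] already forces [A] and [B] to be linear. *)

Section RealNorm.
Variable R : realType.
Local Notation C := R[i].

(** Norms take values in [R[i]], whose order is only partial; the real part gives access to the
    total order and the suprema of [R]. *)
Definition nrm (V : normedZmodType C) (x : V) : R := complex.Re `|x|.

Lemma nrmE (V : normedZmodType C) (x : V) : (nrm x)%:C%C = `|x|.
Proof. by rewrite /nrm RRe_real // normr_real. Qed.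

Lemma nrm_ge0 (V : normedZmodType C) (x : V) : 0 <= nrm x.
Proof. by rewrite -ler0c nrmE normr_ge0. Qed.

Lemma nrm0 (V : normedZmodType C) : nrm (0 : V) = 0.
Proof. by rewrite /nrm normr0. Qed.

Lemma nrm0_eq0 (V : normedZmodType C) (x : V) : nrm x = 0 -> x = 0.
Proof. by move=> h; apply/normr0_eq0; rewrite -nrmE h. Qed.

Lemma nrmN (V : normedZmodType C) (x : V) : nrm (- x) = nrm x.
Proof. by rewrite /nrm normrN. Qed.

Lemma nrmB_sym (V : normedZmodType C) (x y : V) : nrm (x - y) = nrm (y - x).
Proof. by rewrite -nrmN opprB. Qed.

Lemma ler_nrmD (V : normedZmodType C) (x y : V) : nrm (x + y) <= nrm x + nrm y.
Proof. by rewrite -lecR rmorphD /= !nrmE ler_normD. Qed.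

Lemma ler_nrm_dist (V : normedZmodType C) (y x z : V) :
  nrm (x - z) <= nrm (x - y) + nrm (y - z).
Proof. by rewrite -[x - z](subrKA y) ler_nrmD. Qed.

Lemma ler_nrm_sum (V : normedZmodType C) (I : Type) (s : seq I) (P : pred I)
    (f : I -> V) :
  nrm (\sum_(i <- s | P i) f i) <= \sum_(i <- s | P i) nrm (f i).
Proof.
elim/big_rec2: _ => [|i y x _ h]; first by rewrite nrm0.
by apply: le_trans (ler_nrmD _ _) _; rewrite lerD2l.
Qed.

Lemma nrmZ (V : normedModType C) (a : C) (x : V) :
  nrm (a *: x) = nrm a * nrm x.
Proof. by apply: complexI; rewrite rmorphM /= !nrmE normrZ. Qed.

Lemma nrmM (a b : C) : nrm (a * b) = nrm a * nrm b.
Proof. by apply: complexI; rewrite rmorphM /= !nrmE normrM. Qed.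

Lemma nrm1 : nrm (1 : C) = 1.
Proof. by apply: complexI; rewrite nrmE normr1. Qed.

Lemma nrmX (a : C) k : nrm (a ^+ k) = nrm a ^+ k.
Proof. by elim: k => [|k ih]; rewrite ?nrm1 // !exprS nrmM ih. Qed.

Lemma nrm_conj (a : C) : nrm a^* = nrm a.
Proof. by apply: complexI; rewrite !nrmE norm_conjC. Qed.

Lemma nrmV (a : C) : nrm a^-1 = (nrm a)^-1.
Proof. by apply: complexI; rewrite fmorphV /= !nrmE normfV. Qed.

Lemma nrmR (a : R) : nrm (a%:C%C) = `|a|.
Proof. by apply: complexI; rewrite nrmE normc_def /= expr0n addr0 sqrtr_sqr. Qed.

Lemma nrm_Re (a : C) : `|complex.Re a| <= nrm a.
Proof. by rewrite -lecR nrmE normc_ge_Re. Qed.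

Lemma nrm_Im (a : C) : `|complex.Im a| <= nrm a.
Proof.
have := nrm_Re (a * 'i%C); rewrite ReiNIm normrN nrmM.
suff -> : nrm ('i%C : C) = 1 by rewrite mulr1.
by apply: complexI; rewrite nrmE normc_def /= expr0n expr1n add0r sqrtr1.
Qed.

Lemma ler_nrm_ReIm (a : C) : nrm a <= `|complex.Re a| + `|complex.Im a|.
Proof.
rewrite [X in nrm X]complexE; apply: le_trans (ler_nrmD _ _) _.
rewrite nrmM !nrmR; suff -> : nrm ('i%C : C) = 1 by rewrite mul1r.
by apply: complexI; rewrite nrmE normc_def /= expr0n expr1n add0r sqrtr1.
Qed.

Lemma unit_circleE (a : C) : unit_circle a <-> nrm a = 1.
Proof.
rewrite /unit_circle /=; split=> h; first by rewrite /nrm h.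
by rewrite -nrmE h.
Qed.

Lemma nrm1_neq0 (a : C) : nrm a = 1 -> a != 0.
Proof.
move=> h; apply/eqP=> a0; move: h.
by rewrite a0 nrm0 => /eqP; rewrite eq_sym oner_eq0.
Qed.

Lemma nrm1_conjV (a : C) : nrm a = 1 -> a^* = a^-1.
Proof.
move=> h; have a0 := nrm1_neq0 h; apply: (mulfI a0).
by rewrite -normCK -nrmE h divff // expr1n.
Qed.

Lemma nrm_sqr (a : C) : (nrm a ^+ 2)%:C%C = a * a^*.
Proof. by rewrite rmorphXn /= nrmE normCK. Qed.

End RealNorm.

Section Tends.
Variables (R : realType) (I : Type).
Implicit Types (F : set_system I) (d : I -> R).

(** Convergence to 0 in one-sided form, meant for nonnegative [d] such as norms of differences. *)
Definition tends F d := forall e : R, 0 < e -> F [set i | d i < e].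

Lemma tends_le F d d' : Filter F -> (forall i, d i <= d' i) ->
  tends F d' -> tends F d.
Proof.
by move=> FF h t e e0; apply: filterS (t e e0) => i /=; apply: le_lt_trans.
Qed.

Lemma tendsD F d d' : Filter F -> tends F d -> tends F d' ->
  tends F (fun i => d i + d' i).
Proof.
move=> FF t t' e e0; have e20 : 0 < e / 2 by rewrite divr_gt0.
apply: filterS (filterI (t _ e20) (t' _ e20)) => i /= [h h'].
by rewrite [e]splitr ltrD.
Qed.

Lemma tendsZ F (k : R) d : Filter F -> 0 <= k -> tends F d ->
  tends F (fun i => k * d i).
Proof.
move=> FF k0 t e e0; have k1 : 0 < k + 1 by rewrite ltr_wpDl.
apply: filterS (t _ (divr_gt0 e0 k1)) => i /= h.
move: (h); rewrite ltr_pdivlMr // mulrDr mulr1 mulrC => h'.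
have [d0|d0] := ltP (d i) 0; last lra.
by apply: le_lt_trans e0; rewrite mulr_ge0_le0 // ltW.
Qed.

Lemma tends0 F : Filter F -> tends F (fun=> 0).
Proof. by move=> FF e e0; apply: filterS filterT. Qed.

Lemma tends_sum F (J : Type) (s : seq J) (d : J -> I -> R) : Filter F ->
  (forall j, tends F (d j)) -> tends F (fun i => \sum_(j <- s) d j i).
Proof.
move=> FF t; elim: s => [|j s ih].
  by apply: tends_le (tends0 FF) => // i; rewrite big_nil.
by apply: tends_le (tendsD FF (t j) ih) => // i; rewrite big_cons.
Qed.

Lemma tends_ler F (k M : R) d : ProperFilter F -> tends F d ->
  F [set i | k <= M + d i] -> k <= M.
Proof.
move=> FF t h; rewrite leNgt; apply/negP => k0.
have k1 : 0 < k - M by rewrite subr_gt0.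
by have [i /= []] := filter_ex (filterI h (t _ k1)); lra.
Qed.

(** The limit is the supremum of the [t] with [t <= u i] for [F]-almost all [i]. For [t] above it,
    the ultrafilter turns the failure of this condition into [u i < t] almost everywhere. *)
Lemma ultra_real_lim F (u : I -> R) (M : R) : UltraFilter F ->
  (forall i, `|u i| <= M) -> exists c, tends F (fun i => `|u i - c|).
Proof.
move=> FF hM; pose S := [set t : R | F [set i | t <= u i]].
have Sub t : S t -> t <= M.
  move=> /filter_ex [i /= h]; apply: le_trans h _.
  by apply: le_trans (ler_norm _) (hM i).
have supS : has_sup S.
  split; last by exists M => t /Sub.
  exists (- M); apply: filterS filterT => i _ /=.
  by have := hM i; rewrite ler_norml => /andP[].
exists (sup S) => e e0.
have [t St tlt] := sup_adherent e0 supS.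
have nS : ~ S (sup S + e).
  by move=> /(sup_upper_bound supS); rewrite gerDl leNgt e0.
have [//|Fc] := in_ultra_setVsetC [set i | sup S + e <= u i] FF.
apply: filterS (filterI St Fc) => i /= [h1 /negP]; rewrite -ltNge => h2.
rewrite ltr_norml; apply/andP; split; lra.
Qed.

Lemma ultra_complex_lim F (u : I -> R[i]) (M : R) : UltraFilter F ->
  (forall i, nrm (u i) <= M) -> exists c, tends F (fun i => nrm (u i - c)).
Proof.
move=> FF hM.
have [a ta] := @ultra_real_lim F (fun i => complex.Re (u i)) M FF
  (fun i => le_trans (nrm_Re _) (hM i)).
have [b tb] := @ultra_real_lim F (fun i => complex.Im (u i)) M FF
  (fun i => le_trans (nrm_Im _) (hM i)).
exists (a +i* b)%C; apply: tends_le (tendsD _ ta tb) => i.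
by apply: le_trans (ler_nrm_ReIm _) _; case: (u i).
Qed.

End Tends.

(** * Hilbert spaces *)

Section HilbertSpace.
Variables (R : realType) (H : hilbertType R[i]).
Local Notation C := R[i].
Implicit Types (x y z : H) (a b : C).

Lemma innerDl x y z : inner (x + y) z = inner x z + inner y z.
Proof. exact: linearDl. Qed.

Lemma innerZl a x z : inner (a *: x) z = a * inner x z.
Proof. exact: linearZl_LR. Qed.

Lemma innerC x y : inner y x = (inner x y)^*.
Proof. by rewrite (@hermC _ _ _ _ (@inner C H)) /= expr0 mul1r. Qed.

Lemma innerDr x y z : inner z (x + y) = inner z x + inner z y.
Proof. by rewrite innerC innerDl rmorphD /= -!innerC. Qed.

Lemma innerZr a x z : inner z (a *: x) = a^* * inner z x.
Proof. by rewrite innerC innerZl rmorphM /= -innerC. Qed.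

Lemma inner0l x : inner 0 x = 0.
Proof. by rewrite -(scale0r x) innerZl mul0r. Qed.

Lemma inner0r x : inner x 0 = 0.
Proof. by rewrite innerC inner0l rmorph0. Qed.

Lemma innerNl x y : inner (- x) y = - inner x y.
Proof. by rewrite -scaleN1r innerZl mulN1r. Qed.

Lemma innerNr x y : inner x (- y) = - inner x y.
Proof. by rewrite innerC innerNl rmorphN /= -innerC. Qed.

Lemma innerBl x y z : inner (x - y) z = inner x z - inner y z.
Proof. by rewrite innerDl innerNl. Qed.

Lemma innerBr x y z : inner z (x - y) = inner z x - inner z y.
Proof. by rewrite innerDr innerNr. Qed.

Lemma inner_suml (I : Type) (s : seq I) (P : pred I) (f : I -> H) x :
  inner (\sum_(i <- s | P i) f i) x = \sum_(i <- s | P i) inner (f i) x.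
Proof.
by elim/big_rec2: _ => [|i u v _ h]; rewrite ?inner0l // innerDl h.
Qed.

Lemma inner_sumr (I : Type) (s : seq I) (P : pred I) (f : I -> H) x :
  inner x (\sum_(i <- s | P i) f i) = \sum_(i <- s | P i) inner x (f i).
Proof.
by elim/big_rec2: _ => [|i u v _ h]; rewrite ?inner0r // innerDr h.
Qed.

Lemma inner_self x : inner x x = (nrm x ^+ 2)%:C%C.
Proof. by rewrite rmorphXn /= nrmE norm_inner sqrtCK. Qed.

Lemma inner_self_eq0 x : inner x x = 0 -> x = 0.
Proof.
rewrite inner_self => /complexI /eqP; rewrite expf_eq0 /= => /eqP.
exact: nrm0_eq0.
Qed.

Lemma inner_inj x y : (forall z, inner x z = inner y z) -> x = y.
Proof.
move=> h; apply/eqP; rewrite -subr_eq0; apply/eqP/inner_self_eq0.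
by rewrite innerBl h subrr.
Qed.

Lemma nrm_sqrD x y :
  nrm (x + y) ^+ 2 = nrm x ^+ 2 + nrm y ^+ 2 + complex.Re (inner x y) *+ 2.
Proof.
apply: complexI; rewrite -inner_self innerDl !innerDr.
rewrite mulr2n !rmorphD /= -!inner_self (innerC x y).
have -> : (complex.Re (inner x y))%:C%C + (complex.Re (inner x y))%:C%C
    = inner x y + (inner x y)^*.
  by rewrite [RHS]addcJ mulr_natl.
by ring.
Qed.

Lemma nrm_sqrB x y :
  nrm (x - y) ^+ 2 = nrm x ^+ 2 + nrm y ^+ 2 - complex.Re (inner x y) *+ 2.
Proof. by rewrite nrm_sqrD nrmN innerNr raddfN /= mulNrn. Qed.

Lemma pythagoras x y : inner x y = 0 ->
  nrm (x + y) ^+ 2 = nrm x ^+ 2 + nrm y ^+ 2.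
Proof. by move=> h; rewrite nrm_sqrD h /= mul0rn addr0. Qed.

Lemma cauchy_schwarz x y : nrm (inner x y) <= nrm x * nrm y.
Proof.
have [->|/eqP y0] := eqVneq y 0; first by rewrite inner0r nrm0 mulr_ge0 ?nrm_ge0.
have ny : 0 < nrm y.
  by rewrite lt_neqAle nrm_ge0 andbT eq_sym; apply/eqP => /nrm0_eq0.
pose c := inner x y / inner y y.
have yy0 : inner y y != 0 by apply/eqP => /inner_self_eq0.
have orth : inner (x - c *: y) (c *: y) = 0.
  by rewrite innerZr innerBl innerZl /c divfK // subrr mulr0.
have := pythagoras orth; rewrite subrK => h.
have le : nrm (c *: y) <= nrm x.
  by rewrite -(@ler_pXn2r _ 2) ?nnegrE ?nrm_ge0 // h lerDr sqr_ge0.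
move: le; rewrite nrmZ /c nrmM nrmV inner_self nrmR ger0_norm ?sqr_ge0 //.
rewrite expr2 invfM mulrA -mulrA mulVf ?gt_eqF // mulr1.
by rewrite ler_pdivrMr.
Qed.

Lemma tends_inner (I : Type) (F : set_system I) (FF : Filter F) (u : I -> H) x y :
  tends F (fun i => nrm (u i - x)) ->
  tends F (fun i => nrm (inner (u i) y - inner x y)).
Proof.
move=> tx; apply: tends_le (tendsZ FF (nrm_ge0 y) tx) => i.
by rewrite -innerBl mulrC cauchy_schwarz.
Qed.

Lemma tends_cst_eq (I : Type) (F : set_system I) (FF : ProperFilter F)
   (V : normedZmodType C) (u : I -> V) (x y : V) :
  tends F (fun i => nrm (u i - x)) -> tends F (fun i => nrm (u i - y)) -> x = y.
Proof.
move=> tx ty; apply/eqP; rewrite -subr_eq0; apply/eqP/nrm0_eq0/le_anti.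
rewrite nrm_ge0 andbT; apply: (tends_ler FF (tendsD _ tx ty)).
apply: filterS filterT => i _ /=; rewrite add0r.
by apply: le_trans (ler_nrm_dist (u i) _ _) _; rewrite nrmB_sym.
Qed.

Lemma ball_nrmE (V : pseudoMetricNormedZmodType C) (x : V) (e : R) (y : V) :
  ball x (e%:C%C : C) y <-> nrm (x - y) < e.
Proof. by rewrite -ball_normE /ball_ /= -nrmE ltcR. Qed.

Lemma complete_tends (I : Type) (F : set_system I) (FF : ProperFilter F) (u : I -> H) :
  (forall e : R, 0 < e -> exists x, F [set i | nrm (u i - x) < e]) ->
  exists y, tends F (fun i => nrm (u i - y)).
Proof.
move=> h; have cF : cauchy (u @ F).
  apply: cauchy_exP => e e0.
  have er : e = (complex.Re e)%:C%C by rewrite RRe_real ?gtr0_real.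
  have [|x hx] := h (complex.Re e); first by rewrite -ltcR -er.
  exists x; rewrite er; apply: (@filterS _ F _ _ _ _ hx) => i /= hi.
  by apply/ball_nrmE; rewrite nrmB_sym.
pose y := lim (u @ F).
have hy : u @ F --> y := @cauchy_cvg H (u @ F) _ cF.
exists y => e e0.
have /= : nbhs y (ball y (e%:C%C : C)) by apply: nbhsx_ballx; rewrite ltcR.
move=> /hy h'; apply: (@filterS _ F _ _ _ _ h') => i /= /ball_nrmE.
by rewrite nrmB_sym.
Qed.

Lemma closure_nrmP (A : set H) x :
  closure A x <-> forall e : R, 0 < e -> exists2 y, A y & nrm (x - y) < e.
Proof.
split=> [cl e e0|h B].
  have : nbhs x (ball x (e%:C%C : C)) by apply: nbhsx_ballx; rewrite ltcR.
  by move=> /cl [y [Ay /ball_nrmE hy]]; exists y.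
rewrite -nbhs_ballE => -[e /= e0 hB].
have er : e = (complex.Re e)%:C%C by rewrite RRe_real ?gtr0_real.
have [|y Ay hy] := h (complex.Re e); first by rewrite -ltcR -er.
by exists y; split => //; apply: hB; rewrite er; apply/ball_nrmE.
Qed.

Definition linear_subspace (L : set H) :=
  L 0 /\ forall a x y, L x -> L y -> L (a *: x + y).

Definition closed_subspace (L : set H) := linear_subspace L /\ closure L `<=` L.

Lemma subspaceZ L a x : linear_subspace L -> L x -> L (a *: x).
Proof. by move=> [L0 hL] Lx; rewrite -[_ *: _]addr0; apply: hL. Qed.

Lemma subspaceD L x y : linear_subspace L -> L x -> L y -> L (x + y).
Proof. by move=> [L0 hL] Lx Ly; rewrite -[x]scale1r; apply: hL. Qed.

Lemma subspaceB L x y : linear_subspace L -> L x -> L y -> L (x - y).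
Proof. by move=> [L0 hL] Lx Ly; rewrite -scaleN1r addrC; apply: hL. Qed.

Lemma subspace_sum L (I : Type) (s : seq I) (f : I -> H) : linear_subspace L ->
  (forall i, L (f i)) -> L (\sum_(i <- s) f i).
Proof.
move=> sL h; elim/big_ind: _ => // [|x y]; first by case: sL.
exact: subspaceD.
Qed.

Lemma closure_subspace L : linear_subspace L -> closed_subspace (closure L).
Proof.
move=> sL; split; last first.
  by apply: closed_closure.
split; first by apply: subset_closure; case: sL.
move=> a x y /closure_nrmP hx /closure_nrmP hy; apply/closure_nrmP => e e0.
have k0 : 0 < nrm a + 1 by rewrite ltr_wpDl ?nrm_ge0.
have e2 : 0 < e / 2 by rewrite divr_gt0.
have [x' Lx' dx] := hx (e / 2 / (nrm a + 1)) (divr_gt0 e2 k0).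
have [y' Ly' dy] := hy (e / 2) e2.
exists (a *: x' + y'); first by apply: sL.2.
have -> : a *: x + y - (a *: x' + y') = a *: (x - x') + (y - y').
  by rewrite scalerBr opprD addrACA.
apply: le_lt_trans (ler_nrmD _ _) _; rewrite nrmZ [e]splitr ler_ltD //.
move: dx; rewrite ltr_pdivlMr // => dx; apply: le_trans (ltW dx).
by rewrite mulrC ler_wpM2l ?nrm_ge0 // lerDl.
Qed.

Definition orth (A : set H) : set H := [set x | forall y, A y -> inner x y = 0].

Lemma orth_closed A : closed_subspace (orth A).
Proof.
split; first split=> [y _|a x y hx hy z Az]; first exact: inner0l.
  by rewrite innerDl innerZl hx // hy // mulr0 addr0.
move=> x /closure_nrmP hx y Ay; apply/nrm0_eq0/le_anti; rewrite nrm_ge0 andbT.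
rewrite leNgt; apply/negP => k0.
have y0 : 0 < nrm y + 1 by rewrite ltr_wpDl ?nrm_ge0.
have [x' hx' dx] := hx _ (divr_gt0 k0 y0).
have e : inner x y = inner (x - x') y by rewrite innerBl hx' // subr0.
have := cauchy_schwarz (x - x') y; rewrite -e; apply/negP; rewrite -ltNge.
move: dx; rewrite ltr_pdivlMr // => dx; apply: le_lt_trans dx.
by rewrite ler_wpM2l ?nrm_ge0 // lerDl.
Qed.

(** Parallelogram law for [x - y] and [x - z], whose half sum is [x] minus the midpoint of [y] and
    [z]. It makes minimizing sequences Cauchy. *)
Lemma nrm_sub_half x y z :
  nrm (y - z) ^+ 2 = nrm (x - y) ^+ 2 *+ 2 + nrm (x - z) ^+ 2 *+ 2
    - nrm (x - (2^-1 : C) *: (y + z)) ^+ 2 *+ 4.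
Proof.
pose u := x - y; pose v := x - z.
have -> : y - z = v - u by rewrite /u /v opprB [RHS]addrC addrA subrK.
have -> : x - (2^-1 : C) *: (y + z) = (2^-1 : C) *: (u + v).
  rewrite /u /v addrACA -opprD scalerBr; congr (_ - _).
  by rewrite -mulr2n -(scaler_nat 2 x) scalerA mulVf ?scale1r // pnatr_eq0.
rewrite -/u -/v; clearbody u v.
rewrite nrmZ exprMn nrm_sqrB nrm_sqrD nrmV.
have -> : nrm (2 : C) = 2.
  by apply: complexI; rewrite nrmE normr_nat rmorph_nat.
have -> : complex.Re (inner v u) = complex.Re (inner u v).
  by rewrite (innerC u v); case: (inner u v).
by field.
Qed.

Lemma projection L x : closed_subspace L ->
  exists2 y, L y & forall z, L z -> inner (x - y) z = 0.
Proof.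
move=> [sL cL]; pose D := [set nrm (x - y) ^+ 2 | y in L].
have infD : has_inf D.
  split; first by exists (nrm (x - 0) ^+ 2), 0 => //; case: sL.
  by exists 0 => _ [y _ <-]; rewrite sqr_ge0.
pose d := inf D.
have dle y : L y -> d <= nrm (x - y) ^+ 2.
  by move=> Ly; apply: (ge_inf infD.2); exists y.
have /choice[u hu] k : exists y, L y /\ nrm (x - y) ^+ 2 < d + k.+1%:R^-1.
  have k0 : (0 : R) < k.+1%:R^-1 by rewrite invr_gt0.
  by have [_ [y Ly <-] h] := inf_adherent k0 infD; exists y.
have cauchy_u k l : nrm (u k - u l) ^+ 2 <= k.+1%:R^-1 *+ 2 + l.+1%:R^-1 *+ 2.
  rewrite (nrm_sub_half x).
  have := dle ((2^-1 : C) *: (u k + u l)).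
  have := (hu k).2; have := (hu l).2 => hl hk.
  move=> /(_ (subspaceZ _ sL (subspaceD sL (hu k).1 (hu l).1))) hd.
  set A := nrm (x - u k) ^+ 2 in hk *; set B := nrm (x - u l) ^+ 2 in hl *.
  set E := nrm (x - _ *: _) ^+ 2 in hd *.
  set a := k.+1%:R^-1 in hk *; set b := l.+1%:R^-1 in hl *.
  by clearbody A B E a b d; lra.
have inv_small (e : R) : 0 < e -> exists k, (k.+1%:R^-1 : R) < e.
  move=> e0; exists (Num.trunc (e^-1)).
  by rewrite invf_plt ?posrE // truncnS_gt.
have [y ty] : exists y, tends \oo (fun k => nrm (u k - y)).
  apply: complete_tends => e e0.
  have [k hk] := inv_small (e ^+ 2 / 4) (divr_gt0 (exprn_gt0 2 e0) (ltr0Sn _ 3)).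
  exists (u k); exists k => // l /= kl.
  rewrite -(@ltr_pXn2r _ 2) ?nnegrE ?nrm_ge0 ?(ltW e0) //.
  apply: le_lt_trans (cauchy_u l k) _.
  have : (l.+1%:R^-1 : R) <= k.+1%:R^-1 by rewrite lef_pV2 ?posrE // ler_nat ltnS.
  set a := k.+1%:R^-1 in hk *; set b := l.+1%:R^-1; clearbody a b; lra.
have Ly : L y.
  apply: cL; apply/closure_nrmP => e e0; have [k _ hk] := ty e e0.
  by exists (u k); [exact: (hu k).1|rewrite nrmB_sym; apply: hk => /=].
have yd : nrm (x - y) ^+ 2 <= d.
  rewrite leNgt; apply/negP => dlt.
  pose s := nrm (x - y).
  (* The gap is [4 e], while the estimate loses less than [3 e]: one [e] from the minimizing
     sequence and two from [2 s b], where [b (s + 1) < e]. *)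
  pose e := (s ^+ 2 - d) / 4.
  have e0 : 0 < e by rewrite divr_gt0 // subr_gt0.
  have s0 : 0 < s + 1 by rewrite ltr_wpDl ?nrm_ge0.
  have [k1 hk1] := inv_small e e0.
  have [k2 _ hk2] := ty (e / (s + 1)) (divr_gt0 e0 s0).
  pose k := maxn k1 k2.
  have h1 := (hu k).2.
  have h2 : nrm (u k - y) < e / (s + 1) by apply: hk2; rewrite /= leq_maxr.
  have h3 : (k.+1%:R^-1 : R) < e.
    by apply: le_lt_trans hk1; rewrite lef_pV2 ?posrE // ler_nat ltnS leq_maxl.
  have h4 : s <= nrm (x - u k) + nrm (u k - y) by apply: ler_nrm_dist.
  have h5 : nrm (u k - y) * (s + 1) < e by rewrite -ltr_pdivlMr.
  have n0 := nrm_ge0 (u k - y); have m0 := nrm_ge0 (x - u k).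
  have sg : 0 <= s := nrm_ge0 _.
  have E4 : e * 4 = s ^+ 2 - d by rewrite /e divfK.
  move: h1 h4 h5 n0 m0; set a := nrm (x - u k); set b := nrm (u k - y).
  move=> h1 h4 h5 n0 m0.
  have : s ^+ 2 <= a ^+ 2 + 2 * s * b.
    have [ab|ab] := leP s a; first by nra.
    by nra.
  by move: h3 E4 h1 h5; set q := _^-1; nra.
exists y => // z Lz.
have [->|/eqP z0] := eqVneq z 0; first exact: inner0r.
have zz0 : inner z z != 0 by apply/eqP => /inner_self_eq0.
(* Adding to [y] the component [c z] of [x - y] along [z] shortens the distance unless [c z = 0], so
   minimality gives [c = 0]. *)
pose c := inner (x - y) z / inner z z.
have orthz : inner (x - y - c *: z) (c *: z) = 0.
  by rewrite innerZr innerBl innerZl /c divfK // subrr mulr0.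
have := pythagoras orthz; rewrite subrK => h.
have := dle (y + c *: z) (subspaceD sL Ly (subspaceZ c sL Lz)).
rewrite opprD addrA => h2.
have : nrm (c *: z) ^+ 2 <= 0 by move: h h2 yd; lra.
rewrite real_exprn_even_le0 ?num_real // => /eqP/nrm0_eq0/eqP.
rewrite scaler_eq0 (negPf (introN eqP z0)) orbF mulf_eq0 invr_eq0 (negPf zz0).
by rewrite orbF => /eqP.
Qed.

End HilbertSpace.

(** * Riesz representation, adjoints and weak limits *)

Section Riesz.
Variables (R : realType) (H : hilbertType R[i]).
Local Notation C := R[i].
Implicit Types (x y z : H) (a b : C).

Lemma riesz (phi : H -> C) (M : R) :
  (forall a x y, phi (a *: x + y) = a * phi x + phi y) ->
  (forall x, nrm (phi x) <= M * nrm x) ->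
  exists y, forall x, phi x = inner x y.
Proof.
move=> lin bnd.
have phi0 : phi 0 = 0.
  by apply/nrm0_eq0/le_anti; rewrite nrm_ge0 (le_trans (bnd 0)) ?nrm0 ?mulr0.
have phiB x y : phi (x - y) = phi x - phi y.
  by rewrite -scaleN1r addrC lin mulN1r addrC.
have phiZ a x : phi (a *: x) = a * phi x.
  by rewrite -[_ *: x]addr0 lin phi0 addr0.
pose K : set H := [set x | phi x = 0].
have cK : closed_subspace K.
  split; first by split=> // a x y hx hy; rewrite /K /= lin hx hy mulr0 addr0.
  move=> x /closure_nrmP hx; apply/nrm0_eq0/le_anti; rewrite nrm_ge0 andbT.
  rewrite leNgt; apply/negP => k0.
  have M0 : 0 < `|M| + 1 by rewrite ltr_wpDl.
  have [x' hx' dx] := hx _ (divr_gt0 k0 M0).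
  have := bnd (x - x'); rewrite phiB hx' subr0 leNgt => /negP; apply.
  move: dx; rewrite ltr_pdivlMr // mulrC; apply: le_lt_trans.
  by rewrite ler_wpM2r ?nrm_ge0 // (le_trans (ler_norm M)) // lerDl.
have [all0|/existsNP[x0 hx0]] := pselect (forall x, phi x = 0).
  by exists 0 => x; rewrite all0 inner0r.
have [p Kp hp] := projection x0 cK.
pose u := x0 - p.
have pu : phi u = phi x0 by rewrite phiB Kp subr0.
have u0 : inner u u != 0.
  by apply/eqP => /inner_self_eq0 u0; apply: hx0; rewrite -pu u0.
exists (((phi u)^* / inner u u) *: u) => x.
(* [u] is orthogonal to the kernel of [phi]; testing this on a combination of [x] and [u] in the
   kernel expresses [phi x] by [inner x u]. *)
have Kx : K (phi u *: x - phi x *: u) by rewrite /K /= phiB !phiZ mulrC subrr.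
have := hp _ Kx; rewrite innerC => /eqP; rewrite conjC_eq0 -/u => /eqP.
rewrite innerBl !innerZl => /eqP; rewrite subr_eq0 => /eqP h.
rewrite innerZr rmorphM /= conjCK fmorphV /= -innerC.
by rewrite mulrAC h mulfK.
Qed.

Definition adj (A B : H -> H) := forall x y, inner (A x) y = inner x (B y).

Lemma adjC A B : adj A B -> adj B A.
Proof. by move=> h x y; rewrite innerC -h -innerC. Qed.

Lemma adj_comp A B A' B' : adj A B -> adj A' B' -> adj (A \o A') (B' \o B).
Proof. by move=> h h' x y /=; rewrite h h'. Qed.

Lemma adjZ a A B : adj A B -> adj (fun x => a *: A x) (fun x => a^* *: B x).
Proof. by move=> h x y; rewrite innerZl innerZr conjCK h. Qed.

Lemma adj_sum k (A B : 'I_k -> H -> H) : (forall i, adj (A i) (B i)) ->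
  adj (fun x => \sum_i A i x) (fun x => \sum_i B i x).
Proof.
by move=> h x y; rewrite inner_suml inner_sumr; apply: eq_bigr => i _; rewrite h.
Qed.

Lemma adj_lin A B a x y : adj A B -> A (a *: x + y) = a *: A x + A y.
Proof.
by move=> h; apply: inner_inj => z; rewrite h !innerDl !innerZl !h.
Qed.

Lemma adj0 A B : adj A B -> A 0 = 0.
Proof. by move=> h; apply: inner_inj => z; rewrite h !inner0l. Qed.

Lemma adjvZ A B a x : adj A B -> A (a *: x) = a *: A x.
Proof. by move=> h; apply: inner_inj => z; rewrite h !innerZl h. Qed.

Lemma adjvD A B x y : adj A B -> A (x + y) = A x + A y.
Proof. by move=> h; apply: inner_inj => z; rewrite h !innerDl !h. Qed.

Lemma adjvB A B x y : adj A B -> A (x - y) = A x - A y.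
Proof. by move=> h; apply: inner_inj => z; rewrite h !innerBl !h. Qed.

Lemma adjv_sum A B (I : Type) (s : seq I) (P : pred I) (f : I -> H) :
  adj A B -> A (\sum_(i <- s | P i) f i) = \sum_(i <- s | P i) A (f i).
Proof.
move=> h; apply: inner_inj => z; rewrite h !inner_suml.
by apply: eq_bigr => i _; rewrite h.
Qed.

Lemma bounded_adj (A : H -> H) (M : R) :
  (forall a x y, A (a *: x + y) = a *: A x + A y) ->
  (forall x, nrm (A x) <= M * nrm x) -> exists B, adj A B.
Proof.
move=> lin bnd.
suff /choice[B hB] : forall y, exists z, forall x, inner (A x) y = inner x z.
  by exists B => x y; apply: hB.
move=> y; apply: (@riesz _ (M * nrm y)) => [a x z|x].
  by rewrite lin innerDl innerZl.
apply: le_trans (cauchy_schwarz _ _) _; rewrite mulrAC.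
by rewrite ler_wpM2r ?nrm_ge0.
Qed.

(** The eigenspace is the orthogonal complement of the range of [B - a^*], so it is closed without
    any appeal to continuity of [A]. *)
Lemma eigenspace_closed A B a : adj A B -> closed_subspace [set x | A x = a *: x].
Proof.
move=> h; have -> : [set x | A x = a *: x] =
    orth [set B y - a^* *: y | y in [set: H]].
  apply/seteqP; split=> x /=.
    by move=> hx _ [y _ <-]; rewrite innerBr innerZr conjCK -h hx innerZl subrr.
  move=> hx; apply: inner_inj => y; apply/eqP; rewrite -subr_eq0.
  rewrite h innerZl -[a]conjCK -innerZr -innerBr; apply/eqP/hx.
  by exists y.
exact: orth_closed.
Qed.

Lemma closed_subspaceI (L L' : set H) : closed_subspace L -> closed_subspace L' ->
  closed_subspace (L `&` L').
Proof.
move=> [[l0 l] cl] [[l0' l'] cl']; split.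
  by split=> // a x y [hx hx'] [hy hy']; split; [apply: l|apply: l'].
move=> x hx; split; [apply: cl|apply: cl']; move: x hx; apply: closure_subset.
  by apply: subIsetl.
by apply: subIsetr.
Qed.

(** For each [y] the bounded scalars [inner y (g i)] converge along [F]; the limit is a bounded
    linear functional of [y], and Riesz represents it. *)
Lemma weak_ultralim (I : Type) (F : set_system I) (FF : UltraFilter F)
   (g : I -> H) (M : R) :
  (forall i, nrm (g i) <= M) ->
  exists g', forall y, tends F (fun i => nrm (inner (g i) y - inner g' y)).
Proof.
move=> hM.
have hb y i : nrm (inner y (g i)) <= M * nrm y.
  apply: le_trans (cauchy_schwarz _ _) _.
  by rewrite mulrC ler_wpM2r ?nrm_ge0.
have /choice[phi hphi] : forall y, exists c,
    tends F (fun i => nrm (inner y (g i) - c)).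
  by move=> y; apply: (@ultra_complex_lim _ _ F _ (M * nrm y) FF (hb y)).
have [a x y|x|g' hg'] := @riesz phi M.
- apply: (@tends_cst_eq _ _ F _ _ (fun i => inner (a *: x + y) (g i))).
    exact: hphi.
  apply: tends_le (tendsD _ (tendsZ _ (nrm_ge0 a) (hphi x)) (hphi y)) => i.
  rewrite -nrmM innerDl innerZl; apply: le_trans (ler_nrmD _ _).
  by rewrite mulrBr opprD addrACA.
- have PF := @ultra_proper _ _ FF; have hp := hphi x.
  apply: (@tends_ler _ _ F _ _ _ PF hp).
  apply: filterS filterT => i _ /=; rewrite addrC.
  apply: le_trans (lerD (lexx _) (hb x i)).
  by have := ler_nrmD (phi x - inner x (g i)) (inner x (g i)); rewrite subrK nrmB_sym.
exists g' => y; apply: tends_le (hphi y) => i.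
by rewrite hg' (innerC y g') (innerC y (g i)) -rmorphB nrm_conj.
Qed.

End Riesz.

(** * Finite orthonormal systems *)

Section Orthonormal.
Variables (R : realType) (H : hilbertType R[i]).
Local Notation C := R[i].
Implicit Types (x y z : H) (a b : C) (s : seq H).

Definition orthonormal_seq s :=
  uniq s /\ {in s &, forall x y, inner x y = (x == y)%:R}.

(** For orthonormal [s], the orthogonal projection onto the span of [s]. *)
Definition expand s x := \sum_(y <- s) inner x y *: y.

Lemma expand_adj s : adj (expand s) (expand s).
Proof.
move=> x z; rewrite /expand inner_suml inner_sumr; apply: eq_bigr => y _.
by rewrite innerZl innerZr -innerC mulrC.
Qed.

Lemma inner_expand s x y : orthonormal_seq s -> y \in s ->
  inner (expand s x) y = inner x y.
Proof.
move=> [us os] ys; rewrite inner_suml (bigD1_seq y) //= big_seq_cond big1.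
  by rewrite addr0 innerZl (os y y) // eqxx mulr1.
by move=> z /andP[zs zy]; rewrite innerZl (os z y) // (negPf zy) mulr0.
Qed.

Lemma nrm_expand s x : orthonormal_seq s ->
  nrm (expand s x) ^+ 2 = \sum_(y <- s) nrm (inner x y) ^+ 2.
Proof.
move=> os; apply: complexI; rewrite -inner_self {2}/expand inner_sumr.
rewrite rmorph_sum /= big_seq [RHS]big_seq; apply: eq_bigr => y ys.
by rewrite innerZr inner_expand // nrm_sqr mulrC.
Qed.

Lemma expand_lin s a x y : expand s (a *: x + y) = a *: expand s x + expand s y.
Proof. exact: adj_lin (expand_adj s). Qed.

Lemma gram_schmidt (L : set H) (v : seq H) : linear_subspace L ->
  (forall x, x \in v -> L x) ->
  exists s, [/\ orthonormal_seq s, forall x, x \in s -> L x &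
    forall x, x \in v -> expand s x = x].
Proof.
move=> sL; elim: v => [|x v ih] hv; first by exists [::]; split => //; split.
have [|s [[us os] sLs es]] := ih.
  by move=> y yv; apply: hv; rewrite inE yv orbT.
pose u := x - expand s x.
have [u0|u0] := eqVneq u 0.
  exists s; split => // y; rewrite inE => /orP[/eqP->|/es //].
  by move/eqP: u0; rewrite subr_eq0 => /eqP.
have nu : nrm u != 0 by apply: contra u0 => /eqP /nrm0_eq0 ->.
pose e := ((nrm u)^-1%:C%C : C) *: u.
have ue y : y \in s -> inner e y = 0.
  move=> ys; rewrite innerZl innerBl (inner_expand x (conj us os) ys).
  by rewrite subrr mulr0.
have Lu : L u.
  suff Le : L (expand s x) by exact: (subspaceB sL (hv x (mem_head _ _)) Le).
  rewrite /expand big_seq; elim/big_ind: _ => // [|a b|y ys].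
  - by case: sL.
  - exact: subspaceD.
  by apply: subspaceZ => //; apply: sLs.
have ee : inner e e = 1.
  rewrite inner_self nrmZ nrmR ger0_norm ?invr_ge0 ?nrm_ge0 //.
  by rewrite mulVf // expr1n.
have es' : e \notin s.
  by apply/negP => es'; have := ue _ es'; rewrite ee => /eqP; rewrite oner_eq0.
have os' : orthonormal_seq (e :: s).
  split; first by rewrite /= es'.
  move=> y z; rewrite !inE => /orP[/eqP->|ys] /orP[/eqP->|zs].
  - by rewrite ee eqxx.
  - by rewrite ue //; case: eqP => // ez; rewrite ez zs in es'.
  - by rewrite innerC ue // rmorph0; case: eqP => // ez; rewrite -ez ys in es'.
  exact: os.
exists (e :: s); split=> // [y|y].
  by rewrite inE => /orP[/eqP->|/sLs //]; apply: subspaceZ.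
have ex z : expand (e :: s) z = inner z e *: e + expand s z.
  by rewrite /expand big_cons.
rewrite inE ex => /orP[/eqP->|yv].
  suff -> : inner x e *: e = u by rewrite subrK.
  have -> : inner x e = inner u e.
    rewrite innerBl -[LHS]subr0; congr (_ - _).
    rewrite (expand_adj s x e) /expand big_seq big1 ?inner0r //.
    by move=> z zs; rewrite ue // scale0r.
  rewrite {1}/e innerZr [X in X * _]conjc_real inner_self scalerA -!rmorphM /=.
  rewrite expr2 mulrA mulVf // mul1r mulfV //.
  by rewrite scale1r.
rewrite es // -[in X in X *: _](es _ yv) (expand_adj s y e) {1}/expand big_seq.
rewrite big1 ?inner0r ?scale0r ?add0r //.
by move=> z zs; rewrite ue // scale0r.
Qed.

End Orthonormal.

(** * Lower bounds from surjectivity *)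

Section OpenMapping.
Variables (R : realType) (H : hilbertType R[i]).
Local Notation C := R[i].
Implicit Types (x y z : H) (a b : C).

(* Gliding hump: otherwise a series [z] of unit vectors [y k] with
   [B (y k)] tiny has inner products with the [y k] too large for a vector in
   the range of [A]. *)
Lemma adj_bounded_below (A B : H -> H) : adj A B -> (forall x, exists y, A y = x) ->
  exists2 c : R, 0 < c & forall y, nrm y <= c * nrm (B y).
Proof.
move=> h sur; apply: contrapT => nc.
have /choice[y hy] : forall k : nat, exists y, nrm y = 1 /\ nrm (B y) <= 16^-1 ^+ k.
  move=> k; apply: contrapT => ny; apply: nc; exists (16 ^+ k).
    by rewrite exprn_gt0.
  move=> y; rewrite leNgt; apply/negP => lt.
  have y0 : 0 < nrm y by apply: le_lt_trans lt; rewrite mulr_ge0 ?nrm_ge0 ?exprn_ge0.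
  apply: ny; exists ((nrm y)^-1%:C%C *: y); split.
    by rewrite nrmZ nrmR ger0_norm ?invr_ge0 ?nrm_ge0 // mulVf // gt_eqF.
  rewrite (adjvZ _ _ (adjC h)) nrmZ nrmR ger0_norm ?invr_ge0 ?nrm_ge0 //.
  rewrite mulrC ler_pdivrMr // exprVn mulrC ler_pdivlMr ?exprn_gt0 //.
  by rewrite mulrC ltW.
(* The hump at [k] is worth [r k / 2], and all later steps together move the limit [w] by at most
   [r k / 3], so [inner w (y k)] is at least [r k / 6]. If [w = A x], it is at most [16^-k |x|],
   that is [r k ^ 2 |x|], which is absurd for large [k]. *)
pose r k : R := 4^-1 ^+ k.
have r0 k : 0 < r k by rewrite exprn_gt0 // invr_gt0.
have rS k : r k.+1 = r k / 4 by rewrite /r exprSr.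
(* The inner products of [z] and [z + r k y k] with [y k] differ by [r k], so one of the two has
   modulus at least [r k / 2]. *)
pose step k (z : H) := if r k / 2 <= nrm (inner (z + (r k)%:C%C *: y k) (y k))
  then z + (r k)%:C%C *: y k else z.
pose z := fix z k := if k is k'.+1 then step k' (z k') else 0.
have stepd k w : nrm (step k w - w) <= r k.
  rewrite /step; case: ifP => _; last by rewrite subrr nrm0 ltW.
  by rewrite addrC addKr nrmZ nrmR (hy k).1 mulr1 ger0_norm // ltW.
have stepi k w : r k / 2 <= nrm (inner (step k w) (y k)).
  rewrite /step; case: ifP => // /negbT; rewrite -ltNge => lt.
  have e : (r k)%:C%C = inner (w + (r k)%:C%C *: y k) (y k) - inner w (y k).
    by rewrite -innerBl addrC addKr innerZl inner_self (hy k).1 expr1n mulr1.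
  have : r k <= nrm (inner (w + (r k)%:C%C *: y k) (y k)) + nrm (inner w (y k)).
    rewrite -[nrm (inner w _)]nrmN; apply: le_trans (ler_nrmD _ _); rewrite -e.
    by rewrite nrmR ler_norm.
  by move: lt; set a := nrm _; set b := nrm (inner w _); lra.
have tail k l : nrm (z (k + l)%N - z k) <= r k * 4 / 3 - r (k + l)%N * 4 / 3.
  elim: l => [|l ih]; first by rewrite addn0 !subrr nrm0.
  rewrite addnS; apply: le_trans (ler_nrm_dist (z (k + l)%N) _ _) _.
  by have := stepd (k + l)%N (z (k + l)%N); rewrite rS /=; move: ih; lra.
have tail' k l : (k <= l)%N -> nrm (z l - z k) <= r k * 4 / 3.
  move=> kl; rewrite -(subnKC kl); apply: le_trans (tail _ _) _.
  by have := r0 (k + (l - k))%N; lra.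
have rsmall (e : R) : 0 < e -> exists k, r k < e.
  move=> e0; exists (Num.trunc (e^-1)).
  rewrite /r exprVn invf_plt ?posrE ?exprn_gt0 //.
  apply: lt_le_trans (truncnS_gt _) _.
  by rewrite -natrX ler_nat ltn_expl.
have [w tw] : exists w, tends \oo (fun k => nrm (z k - w)).
  apply: complete_tends => e e0.
  have [k hk] := rsmall (e / 2) (divr_gt0 e0 (ltr0Sn _ 1)).
  exists (z k); exists k => // l /= kl.
  by apply: le_lt_trans (tail' _ _ kl) _; lra.
have tw' k : nrm (w - z k) <= r k * 4 / 3.
  apply: (tends_ler _ tw); exists k => // l /= kl.
  rewrite [leRHS]addrC; apply: le_trans (ler_nrm_dist (z l) _ _) _.
  by rewrite nrmB_sym lerD2l tail'.
have [x hx] := sur w.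
have key k : r k / 6 <= nrm x * 16^-1 ^+ k.
  apply: (@le_trans _ _ (nrm (inner w (y k)))); last first.
    rewrite -hx h; apply: le_trans (cauchy_schwarz _ _) _.
    by rewrite ler_wpM2l ?nrm_ge0 // (hy k).2.
  have := stepi k (z k); rewrite -[step k (z k)]/(z k.+1).
  have := tw' k.+1; rewrite rS.
  have : nrm (inner (z k.+1) (y k)) <= nrm (inner w (y k)) + nrm (w - z k.+1).
    apply: (@le_trans _ _ (nrm (inner w (y k)) + nrm (inner (z k.+1 - w) (y k)))).
      by rewrite innerBl; apply: le_trans (ler_nrmD _ _); rewrite addrC subrK.
    rewrite lerD2l nrmB_sym; apply: le_trans (cauchy_schwarz _ _) _.
    by rewrite (hy k).1 mulr1.
  by lra.
have x0 : 0 < 6 * nrm x + 1 by have := nrm_ge0 x; lra.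
have [k] := rsmall (6 * nrm x + 1)^-1 (etrans (invr_gt0 _) x0).
have := key k; have -> : 16^-1 ^+ k = r k * r k :> R.
  by rewrite /r -exprMn; congr (_ ^+ _); field.
rewrite invf_pgt ?posrE //; have := r0 k; have := nrm_ge0 x.
set a := nrm x; set b := r k => a0 b0 h1 h2.
have : b * b^-1 = 1 by rewrite mulfV ?gt_eqF.
have : 0 < b^-1 by rewrite invr_gt0.
move: (b^-1) h2 => c h2 c0 bc; move: b a b0 a0 h1 h2 bc => b a b0 a0 h1 h2 bc.
by clear - b0 a0 h1 h2 bc c0; nra.
Qed.

(** A vector [v] orthogonal to the kernel of [A] is a limit of vectors [B y]. Then [|v|^2] is close
    to [inner (B y) v = inner y (A v)], and [|y| <= c |B y|] bounds it by about [c |v| |A v|]. *)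
Lemma bounded_below_orth_ker (A B : H -> H) : adj A B ->
  (forall x, exists y, A y = x) ->
  exists2 c : R, 0 < c &
    forall v, (forall u, A u = 0 -> inner v u = 0) -> nrm v <= c * nrm (A v).
Proof.
move=> h sur; have [c c0 hc] := adj_bounded_below h sur.
exists c => // v hv.
have sL : linear_subspace (range B).
  split=> [|a _ _ [x _ <-] [y _ <-]]; first by exists 0; rewrite ?(adj0 (adjC h)).
  by exists (a *: x + y); rewrite ?(adj_lin _ _ _ (adjC h)).
pose L := range B.
have [p Lp hp] := projection v (closure_subspace sL).
have Lcl x : L x -> closure L x by apply: subset_closure.
have Au : A (v - p) = 0.
  by apply: inner_inj => z; rewrite h inner0l; apply/hp/Lcl; exists z.
(* [v - p] lies in the kernel of [A], to which both [v] and the closure of the range of [B] are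
   orthogonal. *)
have pv : p = v.
  apply/eqP; rewrite eq_sym -subr_eq0; apply/eqP/inner_self_eq0.
  rewrite {1}innerBl hv // sub0r.
  have : (closure L `<=` orth [set u | A u = 0]).
    suff LL : L `<=` orth [set u | A u = 0].
      by move=> x /(closure_subset LL); apply: (orth_closed _).2.
    by move=> _ [y _ <-] u /= Au0; rewrite (adjC h) Au0 inner0r.
  by move=> /(_ _ Lp _ Au) ->; rewrite oppr0.
rewrite leNgt; apply/negP => lt.
have v0 : 0 < nrm v by apply: le_lt_trans lt; rewrite mulr_ge0 ?nrm_ge0 ?ltW.
pose d := nrm v - c * nrm (A v).
have d0 : 0 < d by rewrite subr_gt0.
have s0 : 0 < nrm v + c * nrm (A v) by rewrite ltr_pwDl // mulr_ge0 ?nrm_ge0 ?ltW.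
(* Replacing [v] by [B y] costs in total [e (|v| + c |A v|)]; this choice makes it half of [|v| d],
   the gap to be contradicted. *)
pose e := nrm v * d / (2 * (nrm v + c * nrm (A v))).
have e0 : 0 < e by rewrite divr_gt0 ?mulr_gt0.
rewrite pv in Lp; have /closure_nrmP/(_ e e0)[_ [y _ <-] dy] := Lp.
have h1 : nrm v ^+ 2 <= e * nrm v + nrm y * nrm (A v).
  have -> : nrm v ^+ 2 = nrm (inner v v).
    by rewrite inner_self nrmR ger0_norm ?sqr_ge0.
  have -> : inner v v = inner (v - B y) v + inner y (A v).
    by rewrite innerBl (adjC h) subrK.
  apply: le_trans (ler_nrmD _ _) _; apply: lerD; last exact: cauchy_schwarz.
  apply: le_trans (cauchy_schwarz _ _) _.
  by rewrite ler_wpM2r ?nrm_ge0 // ltW.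
have h2 : nrm y <= c * (nrm v + e).
  apply: le_trans (hc y) _; rewrite ler_pM2l //.
  have := ler_nrmD (B y - v) v; rewrite subrK => h2; apply: le_trans h2 _.
  by rewrite addrC lerD2l nrmB_sym ltW.
have h3 : e * (nrm v + c * nrm (A v)) = nrm v * d / 2.
  by rewrite /e; field; rewrite gt_eqF.
have := nrm_ge0 (A v); move: h1 h2 h3; rewrite /d.
move: d0; rewrite /d.
set a := nrm v in v0 *; set b := nrm (A v); set q := nrm y; clearbody e a b q.
move=> d0 h1 h2 h3 b0.
have : q * b <= c * (a + e) * b by rewrite ler_wpM2r.
have : 0 < a * (a - c * b) by rewrite mulr_gt0.
by nra.
Qed.
End OpenMapping.

(** * Eigenspaces and projections commuting with T *)

(** [A] is open and closed relative to [Omega]: it is cut out by the interior of the union of [A]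
    with the complement of [Omega], and by the closure of [A]. *)
Lemma connected_locally_constant (C : numClosedFieldType) (Omega A : set C) :
  connected_open Omega -> A !=set0 -> A `<=` Omega ->
  (forall w, Omega w -> exists2 e, 0 < e &
     forall w', Omega w' -> `|w' - w| < e -> (A w' <-> A w)) -> A = Omega.
Proof.
move=> [cO _] A0 AO hA.
have nearw (w : C) (e : C) : 0 < e -> nbhs w [set z : C | `|z - w| < e].
  move=> e0; have : nbhs w (ball w e) by apply: nbhsx_ballx.
  by apply: filterS => z; rewrite -ball_normE /ball_ /= distrC.
apply: cO => //.
  exists ((~` Omega `|` A)°); first exact: open_interior.
  apply/seteqP; split=> [z Az|z [Oz /nbhs_singleton []//]].
  have Oz := AO _ Az; split=> //; rewrite /interior /=.
  have [e e0 he] := hA _ Oz.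
  apply: filterS (nearw z e e0) => z' /= hz'.
  have [Oz'|Oz'] := pselect (Omega z'); last by left.
  by right; apply/(he _ Oz' hz').
exists (closure A); first exact: closed_closure.
apply/seteqP; split=> [z Az|z [Oz clz]].
  by split; [apply: AO|apply: subset_closure].
have [e e0 he] := hA _ Oz.
have [z' [Az' hzz]] := clz _ (nearw z e e0).
by apply/(he _ (AO _ Az') hzz).
Qed.

(** * Linear algebra in finite dimension *)

Section FiniteDimension.
Variables (R : realType) (H : hilbertType R[i]).
Local Notation C := R[i].
Implicit Types (x y z : H) (a b : C) (E : set H).

Lemma has_dimension_subspace n E : has_dimension E n -> linear_subspace E.
Proof.
move=> [e [_ ->]]; split.
  by exists (fun=> 0); rewrite big1 // => i _; rewrite scale0r.
move=> a _ _ [u ->] [v ->]; exists (fun i => a * u i + v i).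
rewrite scaler_sumr -big_split /=; apply: eq_bigr => i _.
by rewrite scalerDl scalerA.
Qed.

Lemma dim_inj_surj n E E' (f : H -> H) :
  (forall a x y, f (a *: x + y) = a *: f x + f y) ->
  has_dimension E n -> has_dimension E' n ->
  (forall x, E x -> E' (f x)) -> (forall x, E x -> f x = 0 -> x = 0) ->
  forall y, E' y -> exists2 x, E x & f x = y.
Proof.
move=> lin [e [ie Ee]] [e' [ie' Ee']] fE fi.
have f0 : f 0 = 0 by have := lin (-1) 0 0; rewrite scaler0 addr0 scaleN1r addNr.
have fsum (u : 'I_n -> C) : f (\sum_i u i *: e i) = \sum_i u i *: f (e i).
  elim/big_rec2: _ => [//|i x y _ <-]; exact: lin.
have /choice[A hA] i : exists a : 'I_n -> C, f (e i) = \sum_j a j *: e' j.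
  have : E' (f (e i)).
    apply: fE; rewrite Ee; exists (fun j => (j == i)%:R).
    rewrite (bigD1 i) //= eqxx scale1r big1 ?addr0 // => j ji.
    by rewrite (negPf ji) scale0r.
  by rewrite Ee'.
pose M : 'M[C]_n := \matrix_(i, j) A i j.
have fM (u : 'rV[C]_n) :
    f (\sum_i u 0 i *: e i) = \sum_j (u *m M) 0 j *: e' j.
  rewrite fsum; under eq_bigr do rewrite hA scaler_sumr.
  rewrite exchange_big /=; apply: eq_bigr => j _.
  rewrite mxE scaler_suml; apply: eq_bigr => i _.
  by rewrite scalerA mxE.
have Mu : M \in unitmx.
  rewrite -row_free_unit; apply: inj_row_free => u uM.
  apply/rowP => i; rewrite mxE; apply: (ie (fun i => u 0 i)).
  apply: fi; first by rewrite Ee; exists (fun i => u 0 i).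
  by rewrite fM uM big1 // => j _; rewrite mxE scale0r.
move=> y; rewrite {1}Ee' => -[b ->].
pose u := (\row_j b j) *m invmx M.
exists (\sum_i u 0 i *: e i); first by rewrite Ee; exists (fun i => u 0 i).
by rewrite fM /u mulmxKV //; apply: eq_bigr => j _; rewrite mxE.
Qed.

Lemma orthogonal_family_le_dim k n E (x : 'I_k -> H) : has_dimension E n ->
  (forall i, E (x i)) -> (forall i, x i <> 0) ->
  (forall i j, i != j -> inner (x i) (x j) = 0) -> (k <= n)%N.
Proof.
move=> [e [ie Ee]] xE x0 ox.
have /choice[A hA] i : exists a : 'I_n -> C, x i = \sum_j a j *: e j.
  by have := xE i; rewrite {1}Ee.
pose M : 'M[C]_(k, n) := \matrix_(i, j) A i j.
suff /eqP <- : row_free M by apply: rank_leq_col.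
apply: inj_row_free => u uM; apply/rowP => i; rewrite mxE.
have s0 : \sum_i u 0 i *: x i = 0.
  under eq_bigr do rewrite hA scaler_sumr.
  rewrite exchange_big /= big1 // => j _.
  under eq_bigr do rewrite scalerA.
  rewrite -scaler_suml; have /rowP/(_ j) := uM; rewrite !mxE => uj.
  rewrite [X in X *: _](_ : _ = 0) ?scale0r // -[RHS]uj.
  by apply: eq_bigr => l _; rewrite mxE.
have := congr1 (fun y => inner y (x i)) s0; rewrite inner0l inner_suml.
rewrite (bigD1 i) //= big1 ?addr0 => [|j ji]; last first.
  by rewrite innerZl ox // mulr0.
rewrite innerZl => /eqP; rewrite mulf_eq0 => /orP[/eqP //|/eqP].
by move=> /inner_self_eq0 /x0.
Qed.

Lemma has_dimension_orthonormal n E : has_dimension E n ->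
  exists s, [/\ orthonormal_seq s, forall x, E (expand s x) &
    forall x, E x -> expand s x = x].
Proof.
move=> hE; have sE := has_dimension_subspace hE; case: hE => e [_ Ee].
have [x|s [os sE' es]] := @gram_schmidt _ _ E (codom e) sE.
  move=> /codomP[i ->]; rewrite Ee; exists (fun j => (j == i)%:R).
  rewrite (bigD1 i) //= eqxx scale1r big1 ?addr0 // => j ji.
  by rewrite (negPf ji) scale0r.
exists s; split=> // [x|x].
  rewrite /expand big_seq; elim/big_ind: _ => [|y z|y ys].
  - by case: sE.
  - exact: subspaceD.
  by apply: subspaceZ => //; apply: sE'.
rewrite {1}Ee => -[a ->]; rewrite (adjv_sum _ _ _ (expand_adj s)).
by apply: eq_bigr => i _; rewrite (adjvZ _ _ (expand_adj s)) es // codom_f.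
Qed.

(** The span of [s] is invariant under [A]. The characteristic polynomial of the matrix of [A] there
    has a root, and a row eigenvector gives the coefficients of [y]. *)
Lemma selfadj_eigenvector (A B : H -> H) (s : seq H) x :
  adj A B -> orthonormal_seq s -> (forall y, y \in s -> expand s (A y) = A y) ->
  x \in s ->
  exists a y, [/\ expand s y = y, y <> 0 & A y = a *: y].
Proof.
move=> hA [us os] sA xs; pose k := size s.
have k0 : (0 < k)%N by rewrite /k; case: (s) xs.
pose e (i : 'I_k) := s`_i.
have es i : e i \in s by rewrite mem_nth.
have ee i j : inner (e i) (e j) = (i == j)%:R.
  rewrite (os _ _ (es i) (es j)); congr (nat_of_bool _)%:R; exact: nth_uniq.
have expE y : expand s y = \sum_i inner y (e i) *: e i.
  by rewrite /expand (big_nth 0) big_mkord.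
pose M : 'M[C]_k := \matrix_(i, j) inner (A (e i)) (e j).
have [a] : exists a, root (char_poly M) a.
  by apply/closed_rootP; rewrite size_char_poly; case: (k) k0.
rewrite -eigenvalue_root_char => /eigenvalueP[v vM v0].
pose y := \sum_i v 0 i *: e i.
have ye j : inner y (e j) = v 0 j.
  rewrite inner_suml (bigD1 j) //= innerZl ee eqxx mulr1 big1 ?addr0 // => i ij.
  by rewrite innerZl ee (negPf ij) mulr0.
exists a, y; split.
- by rewrite expE; apply: eq_bigr => i _; rewrite ye.
- move=> y0; move/eqP: v0; apply; apply/rowP => i.
  by rewrite -ye y0 inner0l mxE.
rewrite (adjv_sum _ _ _ hA).
under eq_bigr => i _.
  rewrite (adjvZ _ _ hA) -(sA _ (es i)) expE scaler_sumr.
  over.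
rewrite exchange_big /= scaler_sumr; apply: eq_bigr => j _.
rewrite scalerA; have /rowP/(_ j) := vM; rewrite !mxE => <-.
by rewrite scaler_suml; apply: eq_bigr => i _; rewrite scalerA mxE.
Qed.

Lemma linear_span_sub (L A : set H) : linear_subspace L -> A `<=` L ->
  linear_span A `<=` L.
Proof.
move=> sL AL _ [k [a [v [hv ->]]]]; apply: subspace_sum => // i.
by apply: subspaceZ => //; apply: AL.
Qed.

End FiniteDimension.

Section Kernels.
Variables (R : realType) (H : hilbertType R[i]).
Local Notation C := R[i].
Implicit Types (x y z : H) (a b : C) (p q r : H -> H).
Variables (T S : H -> H) (Omega : set C) (n : nat).
Hypothesis TS : adj T S.

Definition eigsp (w : C) : set H := [set x | T x = w *: x].

Hypothesis Omega_connected : connected_open Omega.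
Hypothesis T_surj : forall w, Omega w -> forall x, exists y, T y - w *: y = x.
(** Density of the span of the eigenspaces, as an induction principle: what defines a closed
    subspace and holds on every eigenspace holds everywhere. *)
Hypothesis T_span : forall L : set H, closed_subspace L ->
  (forall w, Omega w -> eigsp w `<=` L) -> forall x, L x.
Hypothesis T_dim : forall w, Omega w -> has_dimension (eigsp w) n.

Lemma adj_shift w : adj (fun x => T x - w *: x) (fun x => S x - w^* *: x).
Proof. by move=> x y; rewrite innerBl innerBr innerZl innerZr conjCK TS. Qed.

(** With [s] an orthonormal basis of [ker (T - w)] and [x] in [ker (T - w')], the vector
    [x - expand s x] is orthogonal to [ker (T - w)], and [T - w] sends it to [(w' - w) x]. The lower
    bound on the complement of the kernel applies. *)
Lemma eigsp_near w : Omega w -> exists s, exists2 c : R, 0 < c &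
  [/\ orthonormal_seq s, forall x, eigsp w (expand s x),
      forall x, eigsp w x -> expand s x = x &
      forall w' x, eigsp w' x ->
        nrm (x - expand s x) <= c * nrm (w' - w) * nrm x].
Proof.
move=> Ow; have [s [os sE es]] := has_dimension_orthonormal (T_dim Ow).
have [c c0 hc] := bounded_below_orth_ker (adj_shift w) (T_surj Ow).
exists s, c => //; split=> // w' x xE.
have := hc (x - expand s x); rewrite -mulrA => h; apply: le_trans (h _) _.
  move=> u /eqP; rewrite subr_eq0 => /eqP uE.
  by rewrite innerBl (expand_adj s x u) (es u uE) subrr.
rewrite ler_pM2l // -nrmZ le_eqVlt; apply/orP; left; apply/eqP; congr nrm.
rewrite (adjvB _ _ TS) scalerBr (sE x) [T x]xE scalerBl.
by rewrite opprB addrA subrK.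
Qed.

(** The orthogonal projections onto the reducing subspaces of [T]. *)
Definition red p := [/\ adj p p, forall x, p (p x) = p x &
  forall x, p (T x) = T (p x)].

Lemma red_eigsp p w x : red p -> eigsp w x -> eigsp w (p x).
Proof.
move=> [pa pp pT] xE; rewrite /eigsp /= -pT [T x]xE.
exact: (adjvZ _ _ pa).
Qed.

(** [p] preserves the eigenspace and, being selfadjoint, its orthogonal complement; so it commutes
    with the projection [expand s]. *)
Lemma red_expand p w s x : red p -> (forall x, eigsp w (expand s x)) ->
  (forall x, eigsp w x -> expand s x = x) -> expand s (p x) = p (expand s x).
Proof.
move=> rp sE es; have [pa pp pT] := rp; have sa := expand_adj s.
have -> : expand s (p x) = expand s (p (expand s x)) + expand s (p (x - expand s x)).
  by rewrite (adjvB _ _ pa) (adjvB _ _ sa) addrC subrK.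
rewrite es; last exact: red_eigsp.
rewrite [X in _ + X](_ : _ = 0) ?addr0 //.
apply: inner_inj => z; rewrite inner0l sa pa innerBl.
have zE : eigsp w (p (expand s z)) by apply: red_eigsp.
by rewrite (sa x) (es _ zE) subrr.
Qed.

(** When [c |w' - w| < 1], the projection onto [ker (T - w)] is injective on [ker (T - w')], hence
    bijective between these spaces of equal dimension. It commutes with [p], so vanishing of [p]
    passes both ways. *)
Lemma red_eigsp0_near p w : red p -> Omega w -> exists2 e : R, 0 < e &
  forall w', Omega w' -> nrm (w' - w) < e ->
    (forall x, eigsp w' x -> p x = 0) <-> (forall x, eigsp w x -> p x = 0).
Proof.
move=> rp Ow; have [s [c c0 [os sE es hc]]] := eigsp_near Ow.
exists c^-1; first by rewrite invr_gt0.
move=> w' Ow'; rewrite -[_^-1]mul1r ltr_pdivlMr // => hw.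
have inj x : eigsp w' x -> expand s x = 0 -> x = 0.
  move=> xE x0; have := hc _ _ xE; rewrite x0 subr0 => h.
  apply: nrm0_eq0; have := nrm_ge0 x; move: h hw.
  set u := nrm x; set d := nrm (w' - w) => h hw u0; apply/le_anti/andP; split=> //.
  rewrite leNgt; apply/negP => u1.
  have : d * c * u < 1 * u by rewrite ltr_pM2r.
  by lra.
have pa : adj p p by case: rp.
split=> h.
  move=> y yE; have [x xE <-] := dim_inj_surj (expand_lin s) (T_dim Ow')
    (T_dim Ow) (fun x _ => sE x) inj yE.
  by rewrite -(red_expand _ rp sE es) h // (adj0 (expand_adj s)).
move=> x xE; apply: inj; first exact: red_eigsp.
by rewrite (red_expand _ rp sE es) h.
Qed.

(* The rank of [p] on the eigenspaces vanishes on a clopen subset of [Omega]. *)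
Lemma red_nonzero p w : red p -> (exists x, p x <> 0) -> Omega w ->
  exists2 x, eigsp w x & p x <> 0.
Proof.
move=> rp [x0 px0] Ow; have pa : adj p p by case: rp.
apply: contrapT => nx; apply: px0.
pose A := [set w | Omega w /\ forall x, eigsp w x -> p x = 0].
have Aw : A w.
  by split=> // x xE; apply: contrapT => px; apply: nx; exists x.
have AO : A = Omega.
  apply: (connected_locally_constant Omega_connected); first by exists w.
    by move=> z [].
  move=> z Oz; have [e e0 he] := red_eigsp0_near rp Oz.
  exists (e%:C%C); first by rewrite ltcR.
  move=> z' Oz'; rewrite -nrmE ltcR => /(he _ Oz') hz.
  by split=> -[_ h]; split=> //; apply/hz.
(* The kernel of [p], seen as its eigenspace for 0, is closed and now contains all the eigenspaces
   of [T]. *)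
have := T_span (eigenspace_closed 0 pa); rewrite /= => /(_ _ x0) ->.
  by rewrite scale0r.
by move=> z; rewrite -AO => -[Oz hz] x /hz /= ->; rewrite scale0r.
Qed.

End Kernels.

(** * Schur's lemma and irreducible pieces *)

Section Operators.
Variables (R : realType) (H : hilbertType R[i]).
Local Notation C := R[i].
Implicit Types (x y z : H) (a b : C) (p q r V W : H -> H).

Lemma orthogonal_projection (L : set H) : closed_subspace L ->
  exists r, [/\ adj r r, forall x, r (r x) = r x, forall x, L (r x),
    forall x, L x -> r x = x &
    forall x, (forall z, L z -> inner x z = 0) -> r x = 0].
Proof.
move=> cL; have [sL _] := cL.
have /choice[r hr] x : exists y, L y /\ forall z, L z -> inner (x - y) z = 0.
  by have [y Ly hy] := projection x cL; exists y.
have rL x : L (r x) by case: (hr x).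
have ro x z : L z -> inner (x - r x) z = 0 by case: (hr x) => _; apply.
have rid x : L x -> r x = x.
  move=> Lx; apply/esym/eqP; rewrite -subr_eq0; apply/eqP/inner_self_eq0.
  by rewrite ro //; apply: subspaceB.
have ra : adj r r.
  move=> x y; have := ro y (r x) (rL x); have := ro x (r y) (rL y).
  rewrite !innerBl => /eqP; rewrite subr_eq0 => /eqP e1 /eqP.
  by rewrite subr_eq0 => /eqP e2; rewrite e1 (innerC y) e2 -innerC.
exists r; split=> //; first by move=> x; apply: rid.
move=> x hx; apply: inner_inj => z; rewrite ra hx ?inner0l //.
Qed.

Variables (T S : H -> H).
Hypothesis TS : adj T S.

Local Notation red := (red T).

Lemma red_id : red id.
Proof. by split. Qed.

Lemma red_comm_adj p x : red p -> p (S x) = S (p x).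
Proof.
move=> [pa _ pT]; apply: inner_inj => z.
by rewrite pa (adjC TS) -pT -pa (adjC TS).
Qed.

Lemma red_nrm p x : red p -> nrm (p x) <= nrm x.
Proof.
move=> [pa pp _]; rewrite -(@ler_pXn2r _ 2) ?nnegrE ?nrm_ge0 //.
have o : inner (p x) (x - p x) = 0.
  by rewrite pa (adjvB _ _ pa) pp subrr inner0r.
have := pythagoras o; rewrite addrC subrK => ->.
by rewrite lerDl sqr_ge0.
Qed.

(** Invariance of [L] under the adjoint [S] makes the orthogonal complement invariant under [T], so
    [r] kills [T (x - r x)]. *)
Lemma red_of_invariant (L : set H) r : adj r r -> (forall x, r (r x) = r x) ->
  (forall x, L (r x)) -> (forall x, L x -> r x = x) ->
  (forall x, L x -> L (T x)) -> (forall x, L x -> L (S x)) -> red r.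
Proof.
move=> ra rr rL rid TL SL; split=> // x.
have -> : T x = T (r x) + T (x - r x) by rewrite (adjvB _ _ TS) addrC subrK.
rewrite (adjvD _ _ ra) (rid _ (TL _ (rL x))) [X in _ + X](_ : _ = 0) ?addr0 //.
apply: inner_inj => z; rewrite inner0l ra TS innerBl ra.
by rewrite (rid _ (SL _ (rL z))) subrr.
Qed.

(** A partial isometry [V] with adjoint [W], initial projection [p] and final projection [q], which
    implements the rotation by [l]. For [p = q = id] it is a unitary of the kind in [circular]. *)
Definition piso (l : C) p q V W := [/\ adj V W, forall x, W (V x) = p x,
  forall x, V (W x) = q x & forall x, V (T x) = l *: T (V x)].

Section Piso.
Variables (l : C) (p q V W : H -> H).
Hypotheses (rp : red p) (VW : piso l p q V W).

Lemma piso_dom x : V (p x) = V x.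
Proof.
have [pa pp _] := rp; have [va wv _ _] := VW.
apply/eqP; rewrite -subr_eq0 -(adjvB _ _ va); apply/eqP/inner_self_eq0.
by rewrite va wv (adjvB _ _ pa) pp subrr inner0r.
Qed.

Lemma piso_dom_adj x : p (W x) = W x.
Proof.
have [pa _ _] := rp; have [va _ _ _] := VW.
by apply: inner_inj => z; rewrite pa !(adjC va) piso_dom.
Qed.

Lemma piso_cod x : q (V x) = V x.
Proof. by have [_ wv vw _] := VW; rewrite -vw wv piso_dom. Qed.

Lemma piso_cod_adj x : W (q x) = W x.
Proof. by have [_ wv vw _] := VW; rewrite -vw wv piso_dom_adj. Qed.

Lemma piso_nrm x : nrm (V x) = nrm (p x).
Proof.
have [pa pp _] := rp; have [va wv _ _] := VW.
have : inner (V x) (V x) = inner (p x) (p x) by rewrite va wv pa pp.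
rewrite !inner_self => /complexI /eqP.
by rewrite eqrXn2 ?nrm_ge0 // => /eqP.
Qed.

Lemma piso_nrm_le x : nrm (V x) <= nrm x.
Proof. by rewrite piso_nrm red_nrm. Qed.

(** [W T = W q T = W T V W = l^-1 W V T W = l^-1 T W], using that [p] and [q] commute with [T]. *)
Lemma piso_sym : red q -> l != 0 -> piso l^-1 q p W V.
Proof.
move=> rq l0; have [pa pp pT] := rp; have [qa qq qT] := rq.
have [va wv vw vT] := VW; split=> //; first exact: adjC.
move=> x; rewrite -{1}piso_cod_adj qT -vw.
have -> : T (V (W x)) = l^-1 *: V (T (W x)).
  by rewrite vT scalerA mulVf // scale1r.
by rewrite (adjvZ _ _ (adjC va)) wv pT piso_dom_adj.
Qed.

Lemma piso_scale c : nrm c = 1 ->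
  piso l p q (fun x => c *: V x) (fun x => c^* *: W x).
Proof.
move=> c1; have [va wv vw vT] := VW; have cc : c * c^* = 1.
  by rewrite (nrm1_conjV c1) mulfV // nrm1_neq0.
split=> [|x|x|x]; first exact: adjZ.
- by rewrite (adjvZ _ _ (adjC va)) scalerA mulrC cc scale1r wv.
- by rewrite (adjvZ _ _ va) scalerA cc scale1r vw.
by rewrite (adjvZ _ _ TS) vT !scalerA mulrC.
Qed.

Lemma piso_comp m r V' W' : red q -> piso m q r V' W' ->
  piso (m * l) p r (V' \o V) (W \o W').
Proof.
move=> rq [va' wv' vw' vT']; have [va wv vw vT] := VW.
have qW x : q (W' x) = W' x.
  have [qa qq _] := rq; have dom y : V' (q y) = V' y.
    apply/eqP; rewrite -subr_eq0 -(adjvB _ _ va'); apply/eqP/inner_self_eq0.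
    by rewrite va' wv' (adjvB _ _ qa) qq subrr inner0r.
  by apply: inner_inj => z; rewrite qa !(adjC va') dom.
split=> [|x|x|x] /=; first exact: adj_comp.
- by rewrite wv' piso_cod_adj wv.
- by rewrite vw qW vw'.
by rewrite vT (adjvZ _ _ va') vT' scalerA mulrC.
Qed.

End Piso.

(** Composing with [p] makes the power of exponent 0 equal to [p] instead of the identity. *)
Lemma piso_iter p l V W k : red p -> piso l p p V W ->
  piso (l ^+ k) p p (fun x => iter k V (p x)) (fun x => iter k W (p x)).
Proof.
move=> rp h; have [pa pp pT] := rp; elim: k => [|k ih].
  by split=> //= x; rewrite ?pp // scale1r pT.
have := piso_comp rp ih rp h; rewrite -exprS.
have -> : (fun x => iter k W (p x)) \o W = (fun x => iter k.+1 W (p x)).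
  apply/funext => x /=; rewrite (piso_dom_adj rp h) -iterS iterSr.
  by rewrite (piso_cod_adj rp h).
by [].
Qed.

Definition irr p := [/\ red p, exists x, p x <> 0 &
  forall r, red r -> (forall x, p (r x) = r x) ->
    (forall x, r x = 0) \/ (forall x, r x = p x)].

Variables (Omega : set C) (n : nat).
Hypothesis Omega_connected : connected_open Omega.
Hypothesis T_surj : forall w, Omega w -> forall x, exists y, T y - w *: y = x.
Hypothesis T_span : forall L : set H, closed_subspace L ->
  (forall w, Omega w -> eigsp T w `<=` L) -> forall x, L x.
Hypothesis T_dim : forall w, Omega w -> has_dimension (eigsp T w) n.
Variable w0 : C.
Hypothesis Ow0 : Omega w0.

Let nonzero p : red p -> (exists x, p x <> 0) ->
  exists2 x, eigsp T w0 x & p x <> 0.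
Proof.
move=> rp hp.
exact: (red_nonzero TS Omega_connected T_surj T_span T_dim rp hp).
Qed.

(* A selfadjoint operator commuting with [T] preserves the finite dimensional
   space [p (ker (T - w0))], hence has an eigenvector there; its eigenspace
   reduces [T]. *)
Lemma schur_selfadj p A : irr p -> adj A A -> (forall x, A (T x) = T (A x)) ->
  (forall x, p (A x) = A x) -> exists a, forall x, A x = a *: p x.
Proof.
move=> [rp px0 irrp] Aa AT pA; have [pa pp pT] := rp.
have Ap x : A (p x) = A x.
  by apply: inner_inj => z; rewrite Aa pa pA -Aa.
have AS x : A (S x) = S (A x).
  by apply: inner_inj => z; rewrite Aa (adjC TS) -AT -Aa (adjC TS).
have [x0 x0E x0p] := nonzero rp px0.
have [s0 [os0 sE0 es0]] := has_dimension_orthonormal (T_dim Ow0).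
pose L := eigsp T w0 `&` [set x | p x = x].
have sE : linear_subspace (eigsp T w0) := has_dimension_subspace (T_dim Ow0).
have sL : linear_subspace L.
  split; first by split; [case: sE|rewrite /= (adj0 pa)].
  move=> a x y [xE xp] [yE yp]; split; first by apply: sE.2.
  by rewrite /= (adj_lin _ _ _ pa) xp yp.
have s0E x : x \in s0 -> eigsp T w0 x.
  move=> xs; rewrite -[x](_ : expand s0 x = x) //.
  case: os0 => us os; rewrite /expand (bigD1_seq x) //= os // eqxx scale1r.
  rewrite big_seq_cond big1 ?addr0 // => y /andP[ys yx].
  by rewrite os // eq_sym (negPf yx) scale0r.
have [x|s [os sLs es]] := @gram_schmidt _ _ L [seq p y | y <- s0] sL.
  move=> /mapP[y ys ->]; split; last by rewrite /= pp.
  by apply: red_eigsp rp _; apply: s0E.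
have esL x : L x -> expand s x = x.
  move=> [xE xp]; rewrite -{1 2}xp -(es0 x xE) /expand (adjv_sum _ _ _ pa).
  rewrite -/(expand s _) (adjv_sum _ _ _ (expand_adj s)) big_seq [RHS]big_seq.
  apply: eq_bigr => y ys.
  by rewrite (adjvZ _ _ pa) (adjvZ _ _ (expand_adj s)) es // map_f.
have [s_nil|[z zs]] : s = [::] \/ exists z, z \in s.
  case: (s) => [|z t]; first by left.
  by right; exists z; rewrite mem_head.
  case: x0p; rewrite -[LHS]esL; first by rewrite s_nil /expand big_nil.
  by split; [apply: red_eigsp|rewrite /= pp].
have sA y : y \in s -> expand s (A y) = A y.
  move=> /sLs[yE _]; apply: esL; split; last exact: pA.
  by rewrite /eigsp /= -AT [T y]yE (adjvZ _ _ Aa).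
have [a [y [ey y0 Ay]]] := selfadj_eigenvector Aa os sA zs.
have yL : L y.
  rewrite -ey /expand big_seq; elim/big_ind: _ => [|u v|u us].
  - by case: sL.
  - exact: subspaceD.
  by apply: subspaceZ => //; apply: sLs.
(* The second condition keeps the projection onto [K] below [p]; it is written with eigenvalue 1 so
   that both conditions are closed for the same reason. *)
pose K : set H := [set x | A x = a *: x] `&` [set x | p x = 1 *: x].
have cK : closed_subspace K.
  by apply: closed_subspaceI; [apply: eigenspace_closed Aa|apply: eigenspace_closed pa].
have [r [ra rr rK rid _]] := orthogonal_projection cK.
have rr' : red r.
  apply: (red_of_invariant ra rr rK rid) => x [/= xA xp]; split=> /=.
  - by rewrite AT xA (adjvZ _ _ TS).
  - by rewrite pT xp (adjvZ _ _ TS).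
  - by rewrite AS xA (adjvZ _ _ (adjC TS)).
  - by rewrite (red_comm_adj _ rp) xp (adjvZ _ _ (adjC TS)).
have [x|r0|rpE] := irrp r rr'.
- by have [_ /= ->] := rK x; rewrite scale1r.
- by case: y0; rewrite -(r0 y) rid //; split=> //=; rewrite scale1r; case: yL.
(* Since [r = p] and [A p = A], every [A x] is [A (r x)], and [r x] lies in [K]. *)
exists a => x; rewrite -rpE -Ap -rpE.
by have [/= -> _] := rK x.
Qed.

(** [B A] and [A B] are selfadjoint and commute with [T], hence are multiples of [p] and [q]. The
    factors agree, as [A B A] shows, and are positive; dividing by the square root gives a partial
    isometry. *)
Lemma schur_intertwiner p q A B l : irr p -> irr q -> adj A B -> nrm l = 1 ->
  (forall x, A (T x) = l *: T (A x)) -> (forall x, B (T x) = l^-1 *: T (B x)) ->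
  (forall x, q (A x) = A x) -> (forall x, p (B x) = B x) ->
  (exists x, A x <> 0) -> exists V, exists W, piso l p q V W.
Proof.
move=> ip iq AB l1 AT BT qA pB [x0 Ax0].
have l0 := nrm1_neq0 l1.
have [[pa _ _] _ _] := ip; have [[qa _ _] _ _] := iq.
have BA : adj B A := adjC AB.
have Ap x : A (p x) = A x by apply: inner_inj => z; rewrite AB pa pB -AB.
have [a ha] : exists a, forall x, B (A x) = a *: p x.
  apply: schur_selfadj => // [x y|x]; first by rewrite BA AB.
  by rewrite AT (adjvZ _ _ BA) BT scalerA mulfV // scale1r.
have [b hb] : exists b, forall x, A (B x) = b *: q x.
  apply: schur_selfadj => // [x y|x]; first by rewrite AB BA.
  by rewrite BT (adjvZ _ _ AB) AT scalerA mulVf // scale1r.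
have ab : a = b.
  have : a *: A x0 = b *: A x0 by rewrite -qA -hb ha (adjvZ _ _ AB) Ap qA.
  move/eqP; rewrite -subr_eq0 -scalerBl scaler_eq0 subr_eq0 => /orP[/eqP //|/eqP //].
have px0 : p x0 <> 0 by move=> h; apply: Ax0; rewrite -Ap h (adj0 AB).
have nn x : x <> 0 -> 0 < nrm x.
  by move=> h; rewrite lt_neqAle nrm_ge0 andbT eq_sym; apply/eqP => /nrm0_eq0.
pose t := nrm (A x0) ^+ 2 / nrm (p x0) ^+ 2.
have t0 : 0 < t by rewrite divr_gt0 // exprn_gt0 // nn.
have at_ : a = t%:C%C.
  have [_ pp _] : red p by case: ip.
  have : inner (A x0) (A x0) = a * inner (p x0) (p x0).
    by rewrite -BA ha innerZl -{1}pp pa.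
  have P0 : (nrm (p x0) ^+ 2)%:C%C != 0 :> C.
    by rewrite fmorph_eq0 expf_neq0 // gt_eqF // nn.
  rewrite !inner_self => h; apply: (mulIf P0); rewrite -h -rmorphM /= /t divfK //.
  by rewrite expf_neq0 // gt_eqF // nn.
pose c : C := (Num.sqrt t)^-1%:C%C.
have cc : c^* = c by exact: conjc_real.
have c2a : c * c * a = 1.
  rewrite at_ /c -!rmorphM /= -invfM -expr2 sqr_sqrtr ?ltW // mulVf ?gt_eqF //.
exists (fun x => c *: A x), (fun x => c *: B x); split=> [|x|x|x].
- by move=> x y; rewrite innerZl innerZr cc AB.
- by rewrite (adjvZ _ _ BA) ha !scalerA c2a scale1r.
- by rewrite (adjvZ _ _ AB) hb -ab !scalerA c2a scale1r.
by rewrite AT (adjvZ _ _ TS) !scalerA mulrC.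
Qed.

(** [V + W] and [i (V - W)] are selfadjoint, so [schur_selfadj] makes each a multiple of [p], and
    [V] is a combination of the two. *)
Lemma schur_unitary p V W : irr p -> piso 1 p p V W ->
  exists2 c, nrm c = 1 & forall x, V x = c *: p x.
Proof.
move=> ip VW; have [rp [x0 px0] _] := ip; have [va wv vw vT] := VW.
have [_ _ _ wT] := piso_sym rp VW rp (oner_neq0 _).
have pV x : p (V x) = V x := piso_cod rp VW x.
have pW x : p (W x) = W x := piso_dom_adj rp VW x.
have [pa pp _] := rp.
have vT' x : V (T x) = T (V x) by rewrite vT scale1r.
have wT' x : W (T x) = T (W x) by rewrite wT invr1 scale1r.
have [a1 h1] : exists a, forall x, V x + W x = a *: p x.
  apply: (schur_selfadj ip) => [x y|x|x].
  - by rewrite innerDl innerDr va (adjC va) addrC.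
  - by rewrite (adjvD _ _ TS) vT' wT'.
  by rewrite (adjvD _ _ pa) pV pW.
pose i : C := 'i%C.
have ii : i * i = -1 by rewrite /i -expr2 sqr_i.
have ci : i^* = - i.
  have -> : i^* = (i^*)%C by [].
  by rewrite /i; apply/eqP; rewrite eq_complex /= oppr0 !eqxx.
have [a2 h2] : exists a, forall x, i *: V x - i *: W x = a *: p x.
  apply: (schur_selfadj ip) => [x y|x|x].
  - rewrite innerBl innerBr !innerZl !innerZr ci va (adjC va).
    by rewrite !mulNr opprK addrC.
  - by rewrite (adjvB _ _ TS) !(adjvZ _ _ TS) vT' wT'.
  by rewrite (adjvB _ _ pa) !(adjvZ _ _ pa) pV pW.
pose c := (a1 - i * a2) / 2.
have Vc x : V x = c *: p x.
  rewrite /c; rewrite mulrC -scalerA scalerBl -scalerA -h1 -h2.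
  rewrite [i *: (_ - _)]scalerBr ![i *: (i *: _)]scalerA ii !scaleN1r opprB opprK.
  rewrite addrA addrK -mulr2n -(scaler_nat 2 (V x)) scalerA mulVf ?scale1r //.
exists c => //.
have := piso_nrm rp VW x0; rewrite Vc nrmZ => /eqP.
rewrite -{2}[nrm (p x0)]mul1r => /eqP /mulIf -> //.
by apply/eqP => /nrm0_eq0.
Qed.

(** [V' W] implements the trivial rotation, so it is [c p], and [V' = V' W V = c V]. *)
Lemma piso_unique p l V W V' W' : irr p -> l != 0 ->
  piso l p p V W -> piso l p p V' W' ->
  exists c, [/\ nrm c = 1, forall x, V' x = c *: V x & forall x, W' x = c^* *: W x].
Proof.
move=> ip l0 VW VW'; have [rp _ _] := ip.
have [va wv vw vT] := VW; have [va' wv' vw' vT'] := VW'.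
have := piso_comp rp (piso_sym rp VW rp l0) rp VW'.
rewrite mulfV // => /(schur_unitary ip)[c c1 hc].
have V'E x : V' x = c *: V x.
  rewrite -(piso_dom rp VW') -wv; have /= -> := hc (V x).
  by rewrite (piso_cod rp VW).
exists c; split=> // x.
apply: inner_inj => z; rewrite (adjC va') innerZl (adjC va).
by rewrite V'E innerZr.
Qed.

Section Decomposition.
Variables (k : nat) (p : 'I_k -> H -> H).
Hypothesis rp : forall i, red (p i).
Hypothesis sp : forall x, \sum_i p i x = x.

(** For [y = p j x], the sum of the [|p l y|^2] over all [l] is [|y|^2], which the term [l = j]
    already exhausts. *)
Lemma decomposition_orth i j x : i != j -> p i (p j x) = 0.
Proof.
move=> ij; set y := p j x.
have pi2 l : inner (p l y) y = (nrm (p l y) ^+ 2)%:C%C.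
  by have [pa pp _] := rp l; rewrite -inner_self [RHS]pa pp -pa.
have : inner (\sum_l p l y) y = inner y y by rewrite sp.
rewrite inner_suml (bigD1 j) //= (bigD1 i) //=.
have -> : p j y = y by rewrite /y; case: (rp j).
rewrite -[RHS]addr0 => /addrI /eqP.
rewrite pi2; under eq_bigr do rewrite pi2.
rewrite -rmorph_sum -rmorphD /= fmorph_eq0.
rewrite paddr_eq0 ?sqr_ge0 //; last by rewrite sumr_ge0 // => l _; rewrite sqr_ge0.
by rewrite expf_eq0 /= => /andP[/eqP /nrm0_eq0].
Qed.

(** Each piece contributes a nonzero vector of [ker (T - w0)], and vectors from different pieces are
    orthogonal. *)
Lemma decomposition_size : (forall i, exists x, p i x <> 0) -> (k <= n)%N.
Proof.
move=> pn; have /choice[x hx] i : exists x, eigsp T w0 x /\ p i x <> 0.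
  by have [x xE px] := nonzero (rp i) (pn i); exists x.
apply: (orthogonal_family_le_dim (x := fun i => p i (x i)) (T_dim Ow0)).
- by move=> i; apply: red_eigsp => //; case: (hx i).
- by move=> i; case: (hx i).
move=> i j ij; have [pa _ _] := rp i.
by rewrite pa (decomposition_orth _ ij) inner0r.
Qed.

End Decomposition.

(** Take a decomposition with the largest number of nonzero pieces. A proper nonzero [r] below [p i]
    would allow [p i] to be split into [r] and [p i - r], giving one piece more. *)
Lemma irr_decomposition : (exists x : H, x <> 0) ->
  exists k (p : 'I_k -> H -> H), (forall i, irr (p i)) /\ forall x, \sum_i p i x = x.
Proof.
move=> [x0 x00].
pose P k := `[< exists p : 'I_k -> H -> H, [/\ forall i, red (p i),
  forall i, exists x, p i x <> 0 & forall x, \sum_i p i x = x] >].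
have P1 : exists k, P k.
  exists 1%N; apply/asboolP; exists (fun _ => id); split=> [_|_|x].
  - exact: red_id.
  - by exists x0.
  by rewrite big_ord1.
have Pn k : P k -> (k <= n)%N.
  by move=> /asboolP[p [rp pn sp]]; apply: decomposition_size rp sp pn.
case: (ex_maxnP P1 Pn) => k /asboolP[p [rp pn sp]] kmax.
exists k, p; split=> // i; split=> // r rr pr.
apply: contrapT => /not_orP[r0 rpi].
suff : P k.+1 by move=> /kmax; rewrite ltnn.
have [pa pp pT] := rp i; have [ra rrr rT] := rr.
have rp' x : r (p i x) = r x.
  by apply: inner_inj => z; rewrite ra pa pr -ra.
apply/asboolP.
exists (fun j : 'I_k.+1 => if unlift ord0 j is Some l
  then (if l == i then fun x => p i x - r x else p l) else r).
split.
- move=> j; case: unliftP => [l _|_] //; case: eqP => // _; split=> [x y|x|x].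
  + by rewrite innerBl innerBr pa ra.
  + rewrite (adjvB _ _ pa) (adjvB _ _ ra) pp pr rp' rrr subrr subr0 //.
  by rewrite pT rT (adjvB _ _ TS).
- move=> j; case: unliftP => [l _|_]; last first.
    by apply: contrapT => h; apply: r0 => x; apply: contrapT => rx; apply: h; exists x.
  case: eqP => // _; apply: contrapT => h; apply: rpi => x.
  apply: contrapT => rx; apply: h; exists x => /eqP; rewrite subr_eq0 => /eqP e.
  exact: rx.
move=> x; rewrite big_ord_recl unlift_none.
under eq_bigr => j _ do rewrite liftK.
rewrite -[RHS](sp x) (bigD1 i) //= eqxx [in RHS](bigD1 i) //= addrA [r x + _]addrC subrK.
congr (_ + _).
by apply: eq_bigr => j /negPf ->.
Qed.

Hypothesis T_circular : forall l, nrm l = 1 -> exists U, exists U', piso l id id U U'.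

(** The unitary [U] need not preserve the piece [p i], but some [p j U p i] is nonzero, and Schur's
    lemma turns it into a partial isometry from [p i] to [p j]. *)
Lemma irr_circular k (p : 'I_k -> H -> H) : (forall i, irr (p i)) ->
  (forall x, \sum_i p i x = x) ->
  forall i l, nrm l = 1 -> exists V, exists W, piso l (p i) (p i) V W.
Proof.
move=> ip sp i; have rp j : red (p j) by case: (ip j).
have step l : nrm l = 1 -> exists j, exists V, exists W, piso l (p i) (p j) V W.
  move=> l1; have [U [U' UU]] := T_circular l1.
  have [ua u'u uu' uT] := UU.
  have [_ _ _ u'T] := piso_sym red_id UU red_id (nrm1_neq0 l1).
  have [[pa pp pT] [x px] _] := ip i.
  have [j hj] : exists j, p j (U (p i x)) <> 0.
    apply: contrapT => h; apply: px; rewrite -[p i x]u'u -[U _]sp big1.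
      by rewrite (adj0 (adjC ua)).
    by move=> j _; apply: contrapT => hj; apply: h; exists j.
  have [[qa qq qT] _ _] := ip j.
  exists j; apply: (schur_intertwiner (ip i) (ip j)
    (A := p j \o U \o p i) (B := p i \o U' \o p j) _ l1).
  - by move=> y z /=; rewrite qa ua pa.
  - by move=> y /=; rewrite pT uT (adjvZ _ _ qa) qT.
  - by move=> y /=; rewrite qT u'T (adjvZ _ _ pa) pT.
  - by move=> y /=; rewrite qq.
  - by move=> y /=; rewrite pp.
  by exists x.
(* The classes of the conjugates of [p i] are among the [k] pieces, and a
   rotation has roots of every order. *)
move=> l l1; pose nu : C := (k`!).-root l.
have nuk : nu ^+ k`! = l by rewrite rootCK // fact_gt0.
have nu1 : nrm nu = 1.
  apply: complexI; rewrite nrmE norm_rootC -nrmE l1 rootC1 // fact_gt0 //.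
have nua (a : nat) : nrm (nu ^+ a) = 1 by rewrite nrmX nu1 expr1n.
have /choice[j hj] : forall a : nat, exists j, exists V, exists W,
    piso (nu ^+ a) (p i) (p j) V W by move=> a; apply: step.
(* The [k + 1] exponents from 0 to [k] meet only [k] pieces. Returning along one lift after the
   other implements [nu ^+ (b - a)] on [p i], and [b - a], at most [k], divides the factorial used
   to define [nu]. *)
have [a [b [ab bk jab]]] : exists a b : nat, [/\ (a < b)%N, (b <= k)%N & j a = j b].
  apply: contrapT => h.
  suff /leq_card : injective (fun a : 'I_k.+1 => j a) by rewrite !card_ord ltnn.
  move=> a b jab; apply/val_inj/eqP; case: ltngtP => // ltab; case: h.
    by exists a, b; split=> //; rewrite -ltnS.
  by exists b, a; split=> //; rewrite -ltnS.
have [V [W VW]] := hj a; have [V' [W' VW']] := hj b.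
rewrite -jab in VW'.
have h1 := piso_sym (rp i) VW (rp _) (nrm1_neq0 (nua a)).
have h2 := piso_comp (rp i) VW' (rp _) h1.
have e : (nu ^+ a)^-1 * nu ^+ b = nu ^+ (b - a).
  by rewrite -(subnKC (ltnW ab)) exprD mulKf ?nrm1_neq0 // addKn.
rewrite e in h2.
have ba : (b - a %| k`!)%N.
  by apply: dvdn_fact; rewrite subn_gt0 ab (leq_trans (leq_subr _ _) bk).
have := piso_iter (k`! %/ (b - a)) (rp i) h2.
by rewrite -exprM mulnC divnK // nuk => h; do 2 eexists; exact: h.
Qed.

End Operators.

(** * Compactness of the implementing unitaries *)

Section Compactness.
Variables (R : realType) (H : hilbertType R[i]).
Local Notation C := R[i].
Implicit Types (x y z : H) (a b : C) (p q r V W : H -> H).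
Variables (T S : H -> H).
Hypothesis TS : adj T S.
Variables (Omega : set C) (n : nat).
Hypothesis T_surj : forall w, Omega w -> forall x, exists y, T y - w *: y = x.
Hypothesis T_span : forall L : set H, closed_subspace L ->
  (forall w, Omega w -> eigsp T w `<=` L) -> forall x, L x.
Hypothesis T_dim : forall w, Omega w -> has_dimension (eigsp T w) n.

(* [V] maps [ker (T - w)] into [ker (T - w / l)], which is close to
   [ker (T - w)] for [l] close to 1. *)
Lemma piso_near_eigsp p w : red T p -> Omega w ->
  exists s, exists2 c : R, 0 <= c & orthonormal_seq s /\
    forall l V W x, nrm l = 1 -> piso T l p p V W -> eigsp T w x ->
      nrm (V x - expand s (V x)) <= c * nrm (l - 1) * nrm x.
Proof.
move=> rp Ow; have [s [c c0 [os sE es hc]]] := eigsp_near TS T_surj T_dim Ow.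
exists s, (c * nrm w); first by rewrite mulr_ge0 ?nrm_ge0 // ltW.
split=> // l V W x l1 VW xE.
have [va _ _ vT] := VW; have l0 := nrm1_neq0 l1.
have yE : eigsp T (l^-1 * w) (V x).
  rewrite /eigsp /= -scalerA -(adjvZ _ _ va) -xE vT scalerA mulVf //.
  by rewrite scale1r.
apply: le_trans (hc _ _ yE) _.
have -> : l^-1 * w - w = (l^-1 * (1 - l)) * w.
  by rewrite mulrBr mulr1 mulVf // mulrBl mul1r.
rewrite !nrmM nrmV l1 invr1 mul1r nrmB_sym.
have := piso_nrm_le rp VW x; have := nrm_ge0 w; have := nrm_ge0 (l - 1).
set u := nrm (l - 1); set t := nrm w; set k := nrm x => u0 t0 h.
have -> : c * t * u * k = c * (u * t) * k by ring.
by rewrite ler_wpM2l // !mulr_ge0 // ltW.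
Qed.

Variables (I : Type) (F : set_system I).
Hypothesis FF : UltraFilter F.

Let PF : ProperFilter F := @ultra_proper _ _ FF.

(** The vectors [x] for which [V i x] converges form a closed subspace, because the [V i] are
    contractions. It contains each eigenspace: there [V i x] approaches a fixed finite dimensional
    space, in which bounded coordinates converge along [F]. *)
Lemma piso_ultra_cvg p (l : I -> C) (V W : I -> H -> H) : red T p ->
  (forall i, nrm (l i) = 1) -> tends F (fun i => nrm (l i - 1)) ->
  (forall i, piso T (l i) p p (V i) (W i)) ->
  forall x, exists y, tends F (fun i => nrm (V i x - y)).
Proof.
move=> rp l1 tl VW.
have VL i x : nrm (V i x) <= nrm x := piso_nrm_le rp (VW i) x.
have va i : adj (V i) (W i) by case: (VW i).
pose L : set H := [set x | exists y, tends F (fun i => nrm (V i x - y))].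
apply: (T_span (L := L)).
  split; first split.
  - exists 0; apply: tends_le (tends0 _) => i.
    by rewrite (adj0 (va i)) subrr nrm0.
  - move=> a x x' [y ty] [y' ty']; exists (a *: y + y').
    apply: tends_le (tendsD _ (tendsZ _ (nrm_ge0 a) ty) ty') => i.
    rewrite -nrmZ (adj_lin _ _ _ (va i)) opprD addrACA -scalerBr.
    exact: ler_nrmD.
  move=> x /closure_nrmP hx; apply: complete_tends => e e0.
  have e2 : 0 < e / 2 by rewrite divr_gt0.
  have [x' [y' ty'] dx] := hx _ e2.
  exists y'; apply: filterS (ty' _ e2) => i /= hi.
  apply: le_lt_trans (ler_nrm_dist (V i x') _ _) _.
  rewrite -(adjvB _ _ (va i)) [e]splitr ltrD //.
  exact: le_lt_trans (VL _ _) dx.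
move=> w Ow x xE.
have [s [c c0 [os hc]]] := piso_near_eigsp rp Ow.
have /choice[d hd] : forall z, exists d : C,
    tends F (fun i => nrm (inner (V i x) z - d)).
  move=> z; apply: (@ultra_complex_lim _ _ F _ (nrm x * nrm z) FF) => i.
  apply: le_trans (cauchy_schwarz _ _) _.
  by rewrite ler_wpM2r ?nrm_ge0.
exists (\sum_(z <- s) d z *: z).
have k0 : 0 <= c * nrm x by rewrite mulr_ge0 ?nrm_ge0.
apply: tends_le (tendsD _ (tendsZ _ k0 tl)
  (tends_sum s _ (fun z => tendsZ _ (nrm_ge0 z) (hd z)))) => i.
apply: le_trans (ler_nrm_dist (expand s (V i x)) _ _) _; apply: lerD.
  by apply: le_trans (hc _ _ _ _ (l1 i) (VW i) xE) _; rewrite mulrAC.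
rewrite /expand -sumrB; apply: le_trans (ler_nrm_sum _ _ _) _.
by apply: ler_sum => z _; rewrite -scalerBl nrmZ mulrC.
Qed.

(** The [W i] implement [(l i)^-1], which also tends to 1, so both families converge strongly. This
    is what lets the products [W V] and [V W] pass to the limit. *)
Lemma piso_compact1 p (l : I -> C) (V W : I -> H -> H) : red T p ->
  (forall i, nrm (l i) = 1) -> tends F (fun i => nrm (l i - 1)) ->
  (forall i, piso T (l i) p p (V i) (W i)) ->
  exists V', exists W', [/\ piso T 1 p p V' W',
    forall x, tends F (fun i => nrm (V i x - V' x)) &
    forall x, tends F (fun i => nrm (W i x - W' x))].
Proof.
move=> rp l1 tl VW.
have li1 i : nrm (l i)^-1 = 1 by rewrite nrmV l1 invr1.
have WV i : piso T (l i)^-1 p p (W i) (V i).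
  by apply: piso_sym => //; apply: nrm1_neq0.
have til : tends F (fun i => nrm ((l i)^-1 - 1)).
  apply: tends_le tl => i.
  have -> : (l i)^-1 - 1 = (l i)^-1 * (1 - l i).
    by rewrite mulrBr mulr1 mulVf ?nrm1_neq0.
  by rewrite nrmM li1 mul1r nrmB_sym.
have /choice[V' tV] := piso_ultra_cvg rp l1 tl VW.
have /choice[W' tW] := piso_ultra_cvg rp li1 til WV.
have va i : adj (V i) (W i) by case: (VW i).
have VL i x : nrm (V i x) <= nrm x := piso_nrm_le rp (VW i) x.
have WL i x : nrm (W i x) <= nrm x := piso_nrm_le rp (WV i) x.
exists V', W'; split=> //; split.
- move=> x y; apply: (tends_cst_eq PF (tends_inner _ y (tV x))).
  apply: tends_le (tends_inner _ x (tW y)) => i.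
  by rewrite va (innerC (W i y)) (innerC (W' y)) -rmorphB nrm_conj.
- move=> x; apply: (tends_cst_eq PF (u := fun=> p x)); last first.
    by apply: tends_le (tends0 _) => i; rewrite subrr nrm0.
  apply: tends_le (tendsD _ (tV x) (tW (V' x))) => i.
  have [_ <- _ _] := VW i.
  apply: le_trans (ler_nrm_dist (W i (V' x)) _ _) _.
  by rewrite lerD2r -(adjvB _ _ (adjC (va i))).
- move=> x; apply: (tends_cst_eq PF (u := fun=> p x)); last first.
    by apply: tends_le (tends0 _) => i; rewrite subrr nrm0.
  apply: tends_le (tendsD _ (tW x) (tV (W' x))) => i.
  have [_ _ <- _] := VW i.
  apply: le_trans (ler_nrm_dist (V i (W' x)) _ _) _.
  by rewrite lerD2r -(adjvB _ _ (va i)).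
(* The relation with [T] is checked weakly, with [T] moved to the other side as [S]. *)
move=> x; rewrite scale1r; apply: inner_inj => y.
apply: (tends_cst_eq PF (tends_inner _ y (tV (T x)))).
apply: tends_le (tendsD _ (tends_inner _ (S y) (tV x))
  (tendsZ _ (nrm_ge0 (inner (V' x) (S y))) tl)) => i.
have [_ _ _ vT] := VW i; rewrite vT innerZl !TS.
set u := inner (V i x) _; set u' := inner (V' x) _.
have -> : l i * u - u' = l i * (u - u') + u' * (l i - 1) by ring.
by apply: le_trans (ler_nrmD _ _) _; rewrite !nrmM l1 mul1r.
Qed.

(** Composing with the inverse of one fixed lift of [l0] brings the limit rotation to 1. *)
Lemma piso_compact p (l : I -> C) (l0 : C) (V W : I -> H -> H) V0 W0 : red T p ->
  (forall i, nrm (l i) = 1) -> nrm l0 = 1 -> piso T l0 p p V0 W0 ->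
  tends F (fun i => nrm (l i - l0)) ->
  (forall i, piso T (l i) p p (V i) (W i)) ->
  exists V', exists W', [/\ piso T l0 p p V' W',
    forall x, tends F (fun i => nrm (V i x - V' x)) &
    forall x, tends F (fun i => nrm (W i x - W' x))].
Proof.
move=> rp l1 l01 VW0 tl VW.
have l00 := nrm1_neq0 l01.
have il0 : nrm l0^-1 = 1 by rewrite nrmV l01 invr1.
have [|||V' [W' [VW' tV tW]]] := @piso_compact1 p (fun i => l i * l0^-1)
    (fun i => V i \o W0) (fun i => V0 \o W i) rp.
- by move=> i; rewrite nrmM l1 il0 mul1r.
- apply: tends_le tl => i.
  have -> : l i * l0^-1 - 1 = (l i - l0) * l0^-1 by rewrite mulrBl mulfV.
  by rewrite nrmM il0 mulr1.
- by move=> i; apply: (piso_comp rp (piso_sym rp VW0 rp l00) rp (VW i)).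
exists (V' \o V0), (W0 \o W'); split=> [|x|x].
- by have := piso_comp rp VW0 rp VW'; rewrite mul1r.
- apply: tends_le (tV (V0 x)) => i /=.
  have [_ -> _ _] := VW0; by rewrite (piso_dom rp (VW i)).
apply: tends_le (tW x) => i /=.
have [va w0v0 _ _] := VW0.
rewrite -{1}[W i x](piso_dom_adj rp (VW i)) -w0v0 -(adjvB _ _ (adjC va)).
exact: (piso_nrm_le rp (piso_sym rp VW0 rp l00)).
Qed.

End Compactness.

(** * Finite Fourier analysis and the representation *)

Section Circle.
Variable R : realType.
Local Notation C := R[i].
Implicit Types s t : R.

Definition cis t : C := (cos t +i* sin t)%C.

Lemma cisD s t : cis (s + t) = cis s * cis t.
Proof.
apply/eqP; rewrite eq_complex /= cosD sinD eqxx /=.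
by apply/eqP; ring.
Qed.

Lemma cis0 : cis 0 = 1.
Proof. by rewrite /cis cos0 sin0. Qed.

Lemma nrm_cis t : nrm (cis t) = 1.
Proof.
by apply: complexI; rewrite nrmE normc_def /= cos2Dsin2 sqrtr1.
Qed.

Lemma cisMn t k : cis (t *+ k) = cis t ^+ k.
Proof. by elim: k => [|k ih]; rewrite ?cis0 // mulrS cisD ih exprS. Qed.

Lemma cis2pi : cis (pi *+ 2) = 1.
Proof. by rewrite /cis cos2pi sin2pi. Qed.

Lemma cisB s t : nrm (cis s - cis t) = nrm (cis (s - t) - 1).
Proof.
have -> : cis s - cis t = (cis (s - t) - 1) * cis t.
  by rewrite mulrBl mul1r -cisD subrK.
by rewrite nrmM nrm_cis mulr1.
Qed.

(** By the double angle formula, [cos t = 1] would force [sin (t / 2) = 0], but [t / 2] lies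
    strictly between 0 and pi. *)
Lemma cis_neq1 t : 0 < t < pi *+ 2 -> cis t != 1.
Proof.
move=> /andP[t0 t2]; apply/eqP => -[ct _].
have : 0 < sin (t / 2).
  apply: sin_gt0_pi; rewrite divr_gt0 //= ltr_pdivrMr //.
  by rewrite mulr_natr.
have te : t = (t / 2) *+ 2 by rewrite -mulr_natr divfK.
move: ct; rewrite {1}te cos_mulr2n; have := cos2Dsin2 (t / 2).
set c := cos _; set s := sin _ => h1 h2 s0.
have : s * s = 0 by nra.
by move/eqP; rewrite mulf_eq0 orbb gt_eqF.
Qed.

Lemma cis_near1 (e : R) : 0 < e -> exists2 d : R, 0 < d &
  forall t, `|t| < d -> nrm (cis t - 1) < e.
Proof.
move=> e0; have e2 : 0 < e / 2 by rewrite divr_gt0.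
have hc := @continuous_cos R 0; have hs := @continuous_sin R 0.
move/cvgrPdist_lt/(_ _ e2) : hc => [d1 /= d10 h1].
move/cvgrPdist_lt/(_ _ e2) : hs => [d2 /= d20 h2].
exists (Num.min d1 d2); first by rewrite lt_min d10.
move=> t; rewrite lt_min => /andP[t1 t2].
apply: le_lt_trans (ler_nrm_ReIm _) _; rewrite [e]splitr; apply: ltrD => /=.
  by have := h1 t; rewrite /= sub0r normrN cos0 distrC; apply.
by have := h2 t; rewrite /= sub0r normrN sin0 distrC oppr0; apply.
Qed.

(** The angle is taken nonnegative because it is later approximated through [Num.trunc]. *)
Lemma cis_surj (a : C) : nrm a = 1 -> exists2 t, 0 <= t & cis t = a.
Proof.
case: a => x y a1.
have xy : x ^+ 2 + y ^+ 2 = 1.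
  have := add_Re2_Im2 (x +i* y)%C; rewrite -nrmE a1 expr1n /=.
  by move/complexI.
have x1 : -1 <= x <= 1.
  by rewrite -ler_norml -(@ler_pXn2r _ 2) ?nnegrE // expr1n
    real_normK ?num_real // -xy lerDl sqr_ge0.
have ys : Num.sqrt (1 - x ^+ 2) = `|y|.
  by rewrite -xy addrAC subrr add0r sqrtr_sqr.
have ca : cos (acos x) = x by case: (acos_def x1).
have a0 := acos_ge0 x1; have api := acos_lepi x1.
have [y0|y0] := leP 0 y.
  exists (acos x) => //; rewrite /cis ca sin_acos // ys ger0_norm //.
exists (pi *+ 2 - acos x).
  by rewrite subr_ge0 (le_trans api) // mulr2n lerDl pi_ge0.
rewrite cisD cis2pi mul1r /cis cosN sinN ca sin_acos // ys ltr0_norm //.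
by rewrite opprK.
Qed.

End Circle.

Section Fourier.
Variables (R : realType) (H : hilbertType R[i]).
Local Notation C := R[i].
Implicit Types (x y z e g : H).
Variables (m : nat) (zeta : C) (V W : H -> H).
Hypotheses (m_gt0 : (0 < m)%N) (zeta1 : nrm zeta = 1) (zetam : zeta ^+ m = 1).
Hypothesis zeta_prim : forall k, (0 < k < m)%N -> zeta ^+ k != 1.
Variable p : H -> H.
Hypotheses (pa : adj p p) (pp : forall x, p (p x) = p x).
Hypotheses (VW : adj V W) (WV : forall x, W (V x) = p x).
Hypotheses (pV : forall x, p (V x) = V x) (Vm : forall x, iter m V (p x) = p x).

Let z0 : zeta != 0 := nrm1_neq0 zeta1.
Let m0 : (m%:R : C) != 0.
Proof. by rewrite pnatr_eq0 -lt0n. Qed.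

(** On the range of [p], where [V ^ m = 1], this is the spectral projection of [V] for the
    eigenvalue [zeta ^+ j]. *)
Definition fourier (j : nat) x : H :=
  (m%:R^-1 : C) *: \sum_(k < m) (zeta ^- (j * k)) *: iter k V x.

Lemma sum_zeta k : (k < m)%N ->
  \sum_(j < m) zeta ^- (j * k) = if k == 0%N then m%:R else 0.
Proof.
move=> km; case: eqP => [->|/eqP k0].
  under eq_bigr do rewrite muln0 expr0 invr1.
  by rewrite sumr_const card_ord.
have zk : zeta ^+ k != 1 by apply: zeta_prim; rewrite lt0n k0.
have : (zeta ^- k) ^+ m - 1 = 0.
  by rewrite exprVn -exprM mulnC exprM zetam expr1n invr1 subrr.
rewrite subrX1 => /eqP; rewrite mulf_eq0 subr_eq0 invr_eq1 (negPf zk) /=.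
move=> /eqP S0; rewrite -[RHS]S0; apply: eq_bigr => j _.
by rewrite exprVn -exprM mulnC.
Qed.

Lemma fourier_V j x : p x = x -> V (fourier j x) = zeta ^+ j *: fourier j x.
Proof.
move=> px; rewrite /fourier (adjvZ _ _ VW) (adjv_sum _ _ _ VW).
rewrite scalerA mulrC -scalerA; congr (_ *: _).
(* [V] shifts the sum by one index; the term of index [m] is that of index 0, since [V ^ m] fixes
   [x] and [zeta ^ m = 1]. *)
pose u k := zeta ^- (j * k) *: iter k V x.
have -> : \sum_(k < m) zeta ^- (j * k) *: iter k V x = \sum_(k < m) u k.+1.
  case: m m_gt0 zetam Vm => // m' _ zm vm.
  rewrite big_ord_recl [RHS]big_ord_recr /= addrC; congr (_ + _).
  rewrite /u -{2}px vm px (mulnC j m'.+1) (exprM zeta m'.+1 j) zm expr1n.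
  by rewrite muln0 expr0.
rewrite scaler_sumr; apply: eq_bigr => k _.
rewrite (adjvZ _ _ VW) /u scalerA iterS; congr (_ *: _).
by rewrite mulnS exprD invfM mulrA mulfV ?mul1r // expf_neq0.
Qed.

Lemma fourier_iterV j k x : p x = x ->
  iter k V (fourier j x) = zeta ^+ (j * k) *: fourier j x.
Proof.
move=> px; elim: k => [|k ih]; first by rewrite muln0 scale1r.
by rewrite /= ih (adjvZ _ _ VW) fourier_V // scalerA -exprD mulnS addnC.
Qed.

Lemma fourier_sum x : p x = x -> \sum_(j < m) fourier j x = x.
Proof.
move=> px; rewrite /fourier -scaler_sumr exchange_big /=.
under eq_bigr => k _ do rewrite -scaler_suml sum_zeta //.
case: m m_gt0 m0 => // m' _ m0'; rewrite big_ord_recl /=.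
rewrite big1 => [|k _]; last by rewrite scale0r.
by rewrite addr0 scalerA mulVf // scale1r.
Qed.

Lemma fourier_p j x : p x = x -> p (fourier j x) = fourier j x.
Proof.
move=> px; rewrite -[fourier j x]scale1r -(mulVf (expf_neq0 j z0)) -scalerA.
by rewrite -fourier_V // (adjvZ _ _ pa) pV.
Qed.

Lemma zeta_inj (i j : 'I_m) : zeta ^+ i = zeta ^+ j -> i = j.
Proof.
wlog ij : i j / (i <= j)%N => [h|] e.
  by have [/h|/ltnW/h h'] := leqP i j; [apply|apply/esym/h'].
apply/val_inj/eqP; rewrite eqn_leq ij /= leqNgt; apply/negP => ltij.
have : (0 < j - i < m)%N by rewrite subn_gt0 ltij (leq_ltn_trans (leq_subr _ _)).
move=> /zeta_prim /eqP; apply; apply: (mulfI (expf_neq0 i z0)).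
by rewrite mulr1 -exprD (subnKC ij) e.
Qed.

(** [V] is isometric on the range of [p], so its eigenvectors for distinct unimodular eigenvalues
    are orthogonal. *)
Lemma fourier_orth (i j : 'I_m) x y : p x = x -> p y = y -> i != j ->
  inner (fourier i x) (fourier j y) = 0.
Proof.
move=> px py ij.
have : inner (V (fourier i x)) (V (fourier j y)) = inner (fourier i x) (fourier j y).
  by rewrite VW WV fourier_p.
rewrite !fourier_V // innerZl innerZr mulrA => /eqP.
set u := inner _ _; rewrite -[X in _ == X]mul1r -subr_eq0 -mulrBl mulf_eq0.
move=> /orP[|/eqP //].
rewrite subr_eq0 nrm1_conjV ?nrmX ?zeta1 ?expr1n // => /eqP h.
move: ij; rewrite (@zeta_inj i j) ?eqxx //.
by rewrite -[RHS]mul1r -h divfK // expf_neq0.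
Qed.

Lemma fourier_pythagoras x : p x = x ->
  \sum_(j < m) nrm (fourier j x) ^+ 2 = nrm x ^+ 2.
Proof.
move=> px; apply: complexI; rewrite -inner_self -[in RHS](fourier_sum px).
rewrite inner_suml rmorph_sum; apply: eq_bigr => i _ /=.
rewrite inner_sumr (bigD1 i) //= big1 ?addr0 ?inner_self // => j ji.
by rewrite fourier_orth // eq_sym.
Qed.

Lemma fourier_inner j x y : p x = x ->
  inner (fourier j x) y = m%:R^-1 * \sum_(k < m) zeta ^- (j * k) * inner (iter k V x) y.
Proof.
move=> px; rewrite innerZl inner_suml; congr (_ * _).
by apply: eq_bigr => k _; rewrite innerZl.
Qed.

(** The values [inner (iter k V x) y] are the discrete Fourier transform, in [k], of the values
    [inner (fourier j x) y]. *)
Lemma fourier_parseval x y : p x = x ->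
  \sum_(k < m) nrm (inner (iter k V x) y) ^+ 2 =
  m%:R * \sum_(j < m) nrm (inner (fourier j x) y) ^+ 2.
Proof.
move=> px; apply: complexI; rewrite rmorphM !rmorph_sum /= rmorph_nat.
pose a j := inner (fourier j x) y; pose b k := inner (iter k V x) y.
have bE k : b k = \sum_(j < m) zeta ^+ (j * k) * a j.
  rewrite /b -{1}(fourier_sum px).
  have -> : iter k V (\sum_(j < m) fourier j x) = \sum_(j < m) iter k V (fourier j x).
    by elim: (k) => //= k' ->; rewrite (adjv_sum _ _ _ VW).
  rewrite inner_suml; apply: eq_bigr => j _.
  by rewrite fourier_iterV // innerZl.
have aE j : m%:R * a j = \sum_(k < m) zeta ^- (j * k) * b k.
  by rewrite /a fourier_inner // mulrA mulfV // mul1r.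
under eq_bigr => k _ do rewrite nrm_sqr -/(b k) {2}bE rmorph_sum mulr_sumr.
rewrite exchange_big mulr_sumr /=; apply: eq_bigr => j _.
rewrite nrm_sqr -/(a j) mulrA aE mulr_suml; apply: eq_bigr => k _.
rewrite rmorphM /= (nrm1_conjV (a := zeta ^+ _)) ?nrmX ?zeta1 ?expr1n //.
by rewrite mulrA [b k * _]mulrC.
Qed.

(** Only the [j]-th component of [p y] pairs with [fourier j x]; the bound is
    [a b <= (a^2 + b^2) / 2], summed by Pythagoras for [x] and for [p y]. *)
Lemma fourier_inner_sum x y : p x = x ->
  \sum_(j < m) nrm (inner (fourier j x) y) <= (nrm x ^+ 2 + nrm (p y) ^+ 2) / 2.
Proof.
move=> px; rewrite -(fourier_pythagoras px) -(fourier_pythagoras (pp y)).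
rewrite -big_split /= mulr_suml; apply: ler_sum => j _.
have -> : inner (fourier j x) y = inner (fourier j x) (fourier j (p y)).
  rewrite -{1}(fourier_p j px) pa -{1}(fourier_sum (pp y)) inner_sumr.
  rewrite (bigD1 j) //= big1 ?addr0 // => i ij.
  by rewrite fourier_orth // eq_sym.
apply: le_trans (cauchy_schwarz _ _) _.
set a := nrm _; set b := nrm _.
by have := sqr_ge0 (a - b); rewrite sqrrB; lra.
Qed.

(* Pigeonhole on the Fourier components of [f]: by Parseval one of them has a
   large component on the span of [s]. *)
Lemma fourier_large (s : seq H) f (kappa : R) : 0 < kappa ->
  orthonormal_seq s -> p f = f -> nrm f = 1 ->
  m%:R * kappa <= \sum_(k < m) \sum_(e <- s) nrm (inner (iter k V f) e) ^+ 2 ->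
  exists j g, [/\ V g = zeta ^+ j *: g, nrm g <= 1 &
    kappa / (size s).+1%:R <= \sum_(e <- s) nrm (inner g e)].
Proof.
move=> k0 [us os] pf f1 hk; apply: contrapT => nj.
(* The denominator exceeds [size s], so the bound [kappa <= d * size s] derived below is absurd,
   even for empty [s]. *)
pose d := kappa / (size s).+1%:R.
have d0 : 0 < d by rewrite divr_gt0.
have small j : \sum_(e <- s) nrm (inner (fourier j f) e) < d.
  rewrite ltNge; apply/negP => h; apply: nj; exists j, (fourier j f); split=> //.
    exact: fourier_V.
  (* Reducing [j] modulo [m] makes the component a term of the Pythagoras sum, hence of norm at most
     1. *)
  have -> : fourier j f = fourier (j %% m)%N f.
    rewrite /fourier; congr (_ *: _); apply: eq_bigr => k _; congr (_^-1 *: _).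
    by rewrite !exprM {1}(divn_eq j m) exprD mulnC exprM zetam expr1n mul1r.
  pose j' := Ordinal (ltn_pmod j m_gt0).
  rewrite -f1 -(@ler_pXn2r _ 2) ?nnegrE ?nrm_ge0 // -(fourier_pythagoras pf).
  by rewrite (bigD1 j') //= lerDl sumr_ge0 // => i _; rewrite sqr_ge0.
have : kappa <= d * (size s)%:R.
  have mR : (0 : R) < m%:R by rewrite ltr0n.
  rewrite -(ler_pM2l mR); apply: le_trans hk _.
  rewrite exchange_big /=.
  under eq_bigr => e _ do rewrite fourier_parseval //.
  rewrite -mulr_sumr ler_pM2l //.
  have -> : d * (size s)%:R = \sum_(e <- s) d.
    by rewrite big_const_seq iter_addr_0 count_predT mulr_natr.
  rewrite big_seq [X in _ <= X]big_seq; apply: ler_sum => e es.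
  (* One factor of each square is below [d]; the remaining moduli sum over [j] to at most 1. *)
  apply: (@le_trans _ _ (\sum_(j < m) d * nrm (inner (fourier j f) e))).
    apply: ler_sum => j _; rewrite expr2 ler_wpM2r ?nrm_ge0 //.
    apply/ltW; apply: le_lt_trans (small j); rewrite (bigD1_seq e) //= lerDl.
    by rewrite sumr_ge0 // => i _; rewrite nrm_ge0.
  rewrite -mulr_sumr ler_piMr ?(ltW d0) //.
  apply: le_trans (fourier_inner_sum e pf) _; rewrite f1 expr1n.
  have e1 : nrm e = 1.
    have := inner_self e; rewrite (os e e) // eqxx -(rmorph1 (real_complex R)).
    move=> /complexI /esym/eqP; rewrite sqrp_eq1 ?nrm_ge0 // => /eqP //.
  have : nrm (p e) <= 1.
    rewrite -e1 -(@ler_pXn2r _ 2) ?nnegrE ?nrm_ge0 //.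
    have o : inner (p e) (e - p e) = 0.
      by rewrite pa (adjvB _ _ pa) pp subrr inner0r.
    have := pythagoras o; rewrite addrC subrK => ->.
    by rewrite lerDl sqr_ge0.
  have := nrm_ge0 (p e); set t := nrm (p e) => t0 t1.
  by rewrite ler_pdivrMr //; nra.
rewrite leNgt /d => /negP; apply.
by rewrite mulrAC ltr_pdivrMr // ltr_pM2l // ltr_nat.
Qed.

End Fourier.

(** If [F] misses the set where [d < e], its restriction to the complement is proper and extends to
    an ultrafilter contradicting the assumption. This brings continuity within reach of
    [piso_compact]. *)
Lemma tends_ultra (R : realType) (I : Type) (F : set_system I) (d : I -> R) :
  ProperFilter F ->
  (forall G : set_system I, UltraFilter G -> F `<=` G -> tends G d) -> tends F d.
Proof.
move=> PF h e e0; apply: contrapT => nF.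
pose A := [set i | d i < e].
have PW : ProperFilter (within (~` A) F).
  split; last exact: within_filter.
  move=> Fn; apply: nF; rewrite /within /= in Fn.
  by apply: filterS Fn => i /= ni; apply: contrapT.
have [G [GU WG]] := ultraFilterLemma PW.
have FG : F `<=` G by move=> B FB; apply: WG; apply: filterS FB.
have FnA : F [set i | (~` A) i -> (~` A) i] by apply: filterS filterT => i _.
have GnA : G (~` A) := WG _ FnA.
have := h G GU FG e e0 => GA.
by have [i []] := @filter_ex _ G _ _ (filterI GA GnA).
Qed.

(** * The representation on an irreducible piece *)

Section Representation.
Variables (R : realType) (H : hilbertType R[i]).
Local Notation C := R[i].
Implicit Types (x y z g : H) (p q r V W : H -> H).
Variables (T S : H -> H).
Hypothesis TS : adj T S.
Variables (Omega : set C) (n : nat).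
Hypothesis Omega_connected : connected_open Omega.
Hypothesis T_surj : forall w, Omega w -> forall x, exists y, T y - w *: y = x.
Hypothesis T_span : forall L : set H, closed_subspace L ->
  (forall w, Omega w -> eigsp T w `<=` L) -> forall x, L x.
Hypothesis T_dim : forall w, Omega w -> has_dimension (eigsp T w) n.
Variable w0 : C.
Hypothesis Ow0 : Omega w0.
Variable p : H -> H.
Hypothesis ip : irr T p.
Hypothesis p_circular : forall l, nrm l = 1 -> exists V, exists W, piso T l p p V W.

Let rp : red T p. Proof. by case: ip. Qed.

Lemma piso_fixed_unique l V W V' W' g : nrm l = 1 -> g <> 0 ->
  piso T l p p V W -> piso T l p p V' W' -> V g = g -> V' g = g ->
  forall x, V' x = V x.
Proof.
move=> l1 g0 h h' Vg Vg'.
have [c [c1 hc _]] := piso_unique TS Omega_connected T_surj T_span T_dim Ow0 ip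
  (nrm1_neq0 l1) h h'.
suff c_1 : c = 1 by move=> x; rewrite hc c_1 scale1r.
have : c *: g - 1 *: g = 0 by rewrite -{1}Vg -hc Vg' scale1r subrr.
rewrite -scalerBl => /eqP; rewrite scaler_eq0 subr_eq0 => /orP[/eqP //|/eqP //].
Qed.

Definition zeta (m : nat) : C := cis (pi *+ 2 / m%:R).

Lemma zetaX m k : zeta m ^+ k = cis (pi *+ 2 * k%:R / m%:R).
Proof.
rewrite /zeta -cisMn; congr cis.
by rewrite -[LHS]mulr_natr mulrAC.
Qed.

Lemma nrm_zetaX m k : nrm (zeta m ^+ k) = 1.
Proof. by rewrite zetaX nrm_cis. Qed.

Lemma zeta_exp m : (0 < m)%N -> zeta m ^+ m = 1.
Proof. by move=> m0; rewrite zetaX mulfK ?cis2pi // pnatr_eq0 -lt0n. Qed.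

Lemma zeta_primitive m k : (0 < k < m)%N -> zeta m ^+ k != 1.
Proof.
move=> /andP[k0 km]; rewrite zetaX; apply: cis_neq1.
have p0 : 0 < pi *+ 2 :> R by rewrite mulrn_wgt0 // pi_gt0.
have m0 : (0 : R) < m%:R by rewrite ltr0n (leq_trans _ km).
apply/andP; split; first by rewrite divr_gt0 // mulr_gt0 // ltr0n.
by rewrite ltr_pdivrMr // ltr_pM2l // ltr_nat.
Qed.

(** The [m]-th power of any lift implements the trivial rotation, so it is [c p]; an [m]-th root of
    [c^-1] corrects the phase. *)
Lemma piso_root m : (0 < m)%N -> exists V, exists W,
  piso T (zeta m) p p V W /\ forall x, iter m V (p x) = p x.
Proof.
move=> m0; have zm1 : nrm (zeta m) = 1 by apply: nrm_cis.
have [V [W VW]] := p_circular zm1.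
have := piso_iter m rp VW; rewrite zeta_exp // => h.
have [c c1 hc] := schur_unitary TS Omega_connected T_surj T_span T_dim Ow0 ip h.
pose d := m.-root (c^-1).
have dm : d ^+ m = c^-1 by rewrite rootCK.
have d1 : nrm d = 1.
  by apply: complexI; rewrite nrmE norm_rootC -nrmE nrmV c1 invr1 rootC1.
exists (fun x => d *: V x), (fun x => d^* *: W x); split.
  exact: piso_scale VW _ d1.
have va : adj V W by case: VW.
have it k x : iter k (fun x => d *: V x) x = d ^+ k *: iter k V x.
  elim: k => [|k ih]; first by rewrite scale1r.
  by rewrite /= ih (adjvZ _ _ va) scalerA exprS.
by move=> x; rewrite it hc scalerA dm mulVf ?scale1r ?nrm1_neq0 //.
Qed.

(* The order is a multiple of [N], so that one [N]-th of the powers of [V] lift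
   rotations by an angle less than [2 pi / N], for which [piso_near_eigsp] keeps
   a vector of [ker (T - w0)] close to this space. *)
Lemma fixed_vectors : exists (N : nat) (s : seq H) (delta : R),
  [/\ (0 < N)%N, 0 < delta & forall l : nat, exists V W g,
    [/\ piso T (zeta (N * l.+1)) p p V W, V g = g, nrm g <= 1 &
      delta <= \sum_(e <- s) nrm (inner g e)]].
Proof.
have [pa pp pT] := rp.
have [x xE px] := red_nonzero TS Omega_connected T_surj T_span T_dim rp
  (let: And3 _ h _ := ip in h) Ow0.
have px0 : 0 < nrm (p x).
  by rewrite lt_neqAle nrm_ge0 andbT eq_sym; apply/eqP => /nrm0_eq0.
pose f := (nrm (p x))^-1%:C%C *: p x.
have f1 : nrm f = 1.
  by rewrite nrmZ nrmR ger0_norm ?invr_ge0 ?nrm_ge0 // mulVf // gt_eqF.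
have pf : p f = f by rewrite (adjvZ _ _ pa) pp.
have fE : eigsp T w0 f.
  apply: subspaceZ; first exact: has_dimension_subspace (T_dim Ow0).
  exact: red_eigsp.
have [s [c c0 [os hc]]] := piso_near_eigsp TS T_surj T_dim rp Ow0.
have c1 : 0 < c + 1 by rewrite ltr_wpDl.
(* For angles below [t0] the distance to the span of [s] is at most 1/2, so the projection of a unit
   vector has norm at least 1/2 and squared norm at least 1/4. Using [c + 1] covers [c = 0]. *)
have [t0 t00 ht0] := @cis_near1 R (2 * (c + 1))^-1 (etrans (invr_gt0 _)
  (mulr_gt0 (ltr0Sn _ 1) c1)).
have p0 : 0 < pi *+ 2 :> R by rewrite mulrn_wgt0 // pi_gt0.
pose N := (Num.trunc (pi *+ 2 / t0)).+1.
have N0 : (0 : R) < N%:R by rewrite ltr0n.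
have Nt0 : pi *+ 2 / N%:R < t0.
  by rewrite ltr_pdivrMr // mulrC -ltr_pdivrMr // truncnS_gt.
(* With [m = N (l + 1)], [m * kappa] is [(l + 1) / 4]: the powers of exponent at most [l] contribute
   1/4 each. *)
pose kappa : R := (4 * N%:R)^-1.
have kappa0 : 0 < kappa by rewrite invr_gt0 mulr_gt0.
exists N, s, (kappa / (size s).+1%:R); split=> //.
  by rewrite divr_gt0.
move=> l; pose m := (N * l.+1)%N.
have m0 : (0 < m)%N by rewrite muln_gt0.
have [V [W [VW Vm]]] := piso_root m0.
have large (k : nat) : (k < l.+1)%N ->
    4^-1 <= \sum_(e <- s) nrm (inner (iter k V f) e) ^+ 2.
  move=> kl; have h := piso_iter k rp VW.
  have := hc _ _ _ f (nrm_zetaX m k) h fE; rewrite pf f1 mulr1.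
  have : nrm (iter k V f) = 1 by have := piso_nrm rp h f; rewrite pf f1.
  have : nrm (zeta m ^+ k - 1) < (2 * (c + 1))^-1.
    rewrite zetaX; apply: ht0.
    rewrite ger0_norm ?divr_ge0 ?mulr_ge0 ?(ltW p0) //.
    apply: le_lt_trans Nt0; rewrite /m natrM invfM mulrA mulrAC.
    rewrite ler_pM2r ?invr_gt0 // ler_pdivrMr ?ltr0n // ler_pM2l //.
    by rewrite ler_nat ltnW.
  rewrite -(nrm_expand _ os); set y := iter k V f.
  have := ler_nrm_dist (expand s y) y 0; rewrite !subr0.
  set a := nrm (y - _); set b := nrm (expand s y); set d := nrm (_ - 1).
  move=> h1 h2 h3 h4.
  have b0 : 0 <= b := nrm_ge0 _.
  have : c * d <= 2^-1.
    apply: (@le_trans _ _ ((c + 1) * (2 * (c + 1))^-1)).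
      by apply: ler_pM => //; rewrite ?nrm_ge0 ?lerDl ?(ltW h2).
    by rewrite invfM mulrCA mulfV ?mulr1 // gt_eqF.
  move=> h5; have : 2^-1 <= b by lra.
  by move=> h6; nra.
have [va wv vw _] := VW.
have hk : m%:R * kappa <=
    \sum_(k < m) \sum_(e <- s) nrm (inner (iter k V f) e) ^+ 2.
  have lm : (l.+1 <= m)%N by rewrite leq_pmull.
  pose G k := \sum_(e <- s) nrm (inner (iter k V f) e) ^+ 2.
  have G0 k : 0 <= G k by rewrite sumr_ge0 // => e _; rewrite sqr_ge0.
  rewrite -(big_mkord xpredT G) (big_cat_nat _ lm) //=.
  apply: (@le_trans _ _ (\sum_(0 <= k < l.+1) G k)); last first.
    by rewrite lerDl sumr_ge0.
  have -> : m%:R * kappa = \sum_(0 <= k < l.+1) 4^-1.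
    rewrite sumr_const_nat subn0 -mulr_natl /m natrM /kappa; field.
    by rewrite gt_eqF.
  by rewrite big_nat [leRHS]big_nat; apply: ler_sum => k /andP[_ /large].
have [j [g [Vg g1 hg]]] := fourier_large m0 (nrm_cis _) (zeta_exp m0)
  (@zeta_primitive m) pa pp va wv (piso_cod rp VW) Vm kappa0 os pf f1 hk.
(* [g] is an eigenvector of [V] for [zeta m ^+ j]; this phase makes it a fixed vector and keeps [V]
   a lift of the same rotation. *)
pose u := zeta m ^- j.
have u1 : nrm u = 1 by rewrite nrmV nrm_zetaX invr1.
exists (fun x => u *: V x), (fun x => u^* *: W x), g; split=> //.
  exact: piso_scale VW _ u1.
by rewrite Vg scalerA mulVf ?scale1r // nrm1_neq0 // nrm_zetaX.
Qed.

Lemma irr_representation : exists Vr Wr : C -> H -> H,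
  [/\ forall l, nrm l = 1 -> piso T l p p (Vr l) (Wr l),
      forall l m, nrm l = 1 -> nrm m = 1 ->
        forall x, Vr (l * m) x = Vr l (Vr m x) &
      forall (F : set_system C) l0 x, ProperFilter F -> F [set l | nrm l = 1] ->
        nrm l0 = 1 -> tends F (fun l => nrm (l - l0)) ->
        tends F (fun l => nrm (Vr l x - Vr l0 x))].
Proof.
have [N [s [delta [N0 d0 /choice[V_ hV]]]]] := fixed_vectors.
have /choice[W_ {}hV] := hV.
have /choice[g_ {}hV] := hV.
have [F0 [FU F0le]] := @ultraFilterLemma _ \oo _.
have PF0 : ProperFilter F0 := @ultra_proper _ _ FU.
have [|g hg] := @weak_ultralim _ H _ F0 FU g_ 1.
  by move=> l; case: (hV l).
(* The lower bound [delta] involves only the finite list [s], so it survives the weak limit. *)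
have g0 : g <> 0.
  move=> g0; move: d0; apply/negP; rewrite -leNgt.
  have t0 : tends F0 (fun i => \sum_(e <- s) nrm (inner (g_ i) e - inner g e)).
    exact: tends_sum.
  apply: (@tends_ler _ _ F0 _ _ _ PF0 t0).
  apply: filterS filterT => l _ /=; rewrite add0r.
  have [_ _ _ h] := hV l; apply: le_trans h _.
  by apply: ler_sum => e _; rewrite g0 inner0l subr0.
have p0 : 0 < pi *+ 2 :> R by rewrite mulrn_wgt0 // pi_gt0.
have lift l : nrm l = 1 -> exists V, exists W, piso T l p p V W /\ V g = g.
  move=> l1; have [t t0 tl] := cis_surj l1.
  have [V0 [W0 VW0]] := p_circular l1.
  pose m k := (N * k.+1)%N.
  (* The multiple of [2 pi / m k] just below [t]. The power of [V_ k] with this exponent lifts a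
     rotation tending to [l] and still fixes [g_ k]. *)
  pose a k := Num.trunc (t * (m k)%:R / (pi *+ 2)).
  have m0 k : (0 : R) < (m k)%:R by rewrite ltr0n muln_gt0 N0.
  have VWa k := piso_iter (a k) rp (let: And4 h _ _ _ := hV k in h).
  have dist k : `|pi *+ 2 * (a k)%:R / (m k)%:R - t| <= pi *+ 2 / k.+1%:R.
    have /truncn_itv/andP[] : 0 <= t * (m k)%:R / (pi *+ 2).
      by rewrite divr_ge0 ?mulr_ge0 ?(ltW p0) ?(ltW (m0 k)).
    rewrite -/(a k) ler_pdivlMr // ltr_pdivrMr // => h1 h2.
    rewrite ler_norml; apply/andP; split.
      apply: (@le_trans _ _ (- (pi *+ 2 / (m k)%:R))).
        rewrite lerN2 ler_pM2l // lef_pV2 ?posrE // ler_nat.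
        by rewrite leq_pmull.
      have : t <= pi *+ 2 * (a k).+1%:R / (m k)%:R.
        by rewrite ler_pdivlMr // [leRHS]mulrC ltW.
      by rewrite -natr1 mulrDr mulr1 mulrDl; lra.
    apply: (@le_trans _ _ 0); last by rewrite divr_ge0 ?(ltW p0).
    by rewrite subr_le0 ler_pdivrMr // mulrC.
  have tl' : tends F0 (fun k => nrm (zeta (m k) ^+ a k - l)).
    move=> e e0; have [d dd hd] := cis_near1 e0; apply: F0le.
    exists (Num.trunc (pi *+ 2 / d)) => // k /= hk.
    rewrite zetaX -tl cisB; apply: hd; apply: le_lt_trans (dist k) _.
    rewrite ltr_pdivrMr // mulrC -ltr_pdivrMr //.
    by apply: lt_le_trans (truncnS_gt _) _; rewrite ler_nat ltnS.
  have [V' [W' [VW' tV tW]]] := piso_compact TS T_surj T_span T_dim FU rp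
    (fun k => nrm_zetaX (m k) (a k)) l1 VW0 tl' VWa.
  (* That [V'] fixes [g] is read off against [y]: the [g_ k] converge only weakly, but the adjoint
     powers applied to [y] converge strongly to [W' y], so the inner products converge. *)
  exists V', W'; split=> //; apply: inner_inj => y.
  have [va _ _ _] := VW'; rewrite va.
  apply/esym/(@tends_cst_eq _ _ F0 PF0 _ _ _ _ (hg y)).
  apply: tends_le (tendsD _ (tW y) (hg (W' y))) => k.
  have [[vka _ _ vT] Vg g1 _] := hV k.
  have pg : p (g_ k) = g_ k.
    by rewrite -Vg (piso_cod rp (let: And4 h _ _ _ := hV k in h)).
  have itg : iter (a k) (V_ k) (p (g_ k)) = g_ k.
    by rewrite pg; elim: (a k) => //= b ->.
  have [ita _ _ _] := VWa k.
  have -> : inner (g_ k) y = inner (g_ k) (iter (a k) (W_ k) (p y)).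
    by rewrite -{1}itg ita.
  set z := iter _ _ (p y).
  have -> : inner (g_ k) z - inner g (W' y) =
      inner (g_ k) (z - W' y) + (inner (g_ k) (W' y) - inner g (W' y)).
    by rewrite innerBr addrA subrK.
  apply: le_trans (ler_nrmD _ _) _; rewrite lerD2r.
  apply: le_trans (cauchy_schwarz _ _) _.
  by rewrite -[leRHS]mul1r ler_wpM2r ?nrm_ge0.
have /choice[VW hVW] l : exists VW : (H -> H) * (H -> H), nrm l = 1 ->
    piso T l p p VW.1 VW.2 /\ VW.1 g = g.
  have [/lift[V [W h]]|nl] := pselect (nrm l = 1); first by exists (V, W).
  by exists (id, id).
exists (fun l => (VW l).1), (fun l => (VW l).2); split.
- by move=> l /hVW[].
- move=> l m l1 m1; have [hl gl] := hVW _ l1; have [hm gm] := hVW _ m1.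
  have lm1 : nrm (l * m) = 1 by rewrite nrmM l1 m1 mulr1.
  have [hlm glm] := hVW _ lm1.
  apply: (piso_fixed_unique lm1 g0 (piso_comp rp hm rp hl) hlm _ glm).
  by rewrite /= gm gl.
move=> F l0 x PF F1 l01 tF.
apply: tends_ultra => G GU FG.
have PG : ProperFilter G := @ultra_proper _ _ GU.
(* Compactness asks for a lift at every index, so points off the circle are replaced by 1; this
   changes nothing on a set belonging to [G]. *)
pose c l : C := if nrm l == 1 then l else 1.
have c1 l : nrm (c l) = 1 by rewrite /c; case: eqP => // _; apply: nrm1.
have cl l : nrm l = 1 -> c l = l by rewrite /c => ->; rewrite eqxx.
have tG : tends G (fun l => nrm (c l - l0)).
  move=> e e0; apply: filterS (filterI (FG _ F1) (FG _ (tF e e0))) => l /= [h].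
  by rewrite cl.
have [h0 hg0] := hVW _ l01.
have [V' [W' [VW' tV _]]] := piso_compact TS T_surj T_span T_dim GU rp
    c1 l01 h0 tG (fun l => (hVW _ (c1 l)).1).
have V'g : V' g = g.
  apply: (@tends_cst_eq _ _ G PG _ _ _ _ (tV g)).
  by apply: tends_le (tends0 _) => l; rewrite (hVW _ (c1 l)).2 subrr nrm0.
(* The ultralimit is a lift of [l0] that fixes [g], hence it is the chosen one. *)
have V'E := piso_fixed_unique l01 g0 h0 VW' hg0 V'g.
move=> e e0; apply: filterS (filterI (FG _ F1) (tV x e e0)) => l /= [h].
by rewrite cl // V'E.
Qed.

End Representation.

(** * Continuity on the circle and assembly of the pieces *)

Section CircleFilter.
Variable C : numClosedFieldType.

Definition circle_nbhs (l0 : C) : set_system C := within unit_circle (nbhs l0).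

Lemma circle_nbhs_proper l0 : unit_circle l0 -> ProperFilter (circle_nbhs l0).
Proof.
move=> l1; split; last exact: within_filter.
by move=> /nbhs_singleton /(_ l1).
Qed.

Lemma circle_nbhs_circle l0 : circle_nbhs l0 unit_circle.
Proof. exact: withinT. Qed.

Lemma circle_nbhs_dist l0 (e : C) : 0 < e -> circle_nbhs l0 [set l | `|l - l0| < e].
Proof.
move=> e0; have : nbhs l0 (ball l0 e) by apply: nbhsx_ballx.
by apply: filterS => l + _; rewrite -ball_normE /ball_ /= distrC.
Qed.

Lemma continuous_within_circle (H : normedModType C) (f : C -> H) :
  (forall l0, unit_circle l0 -> forall e : C, 0 < e ->
     circle_nbhs l0 [set l | `|f l - f l0| < e]) ->
  {within unit_circle, continuous f}.
Proof.
move=> hf; apply/subspace_continuousP => l0 l1.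
apply/cvgrPdist_lt => e e0; have := hf l0 l1 e e0.
by apply: filterS => l /=; rewrite distrC.
Qed.

End CircleFilter.

Lemma adj_linear (R : realType) (H : hilbertType R[i]) (A B : H -> H) :
  adj A B -> exists L : {linear H -> H}, forall x, L x = A x.
Proof.
move=> h; have lin : linear A by move=> a x y; apply: adj_lin h.
pose m := GRing.isLinear.Build _ _ _ _ A lin.
pose L : {linear H -> H} := HB.pack A m.
by exists L.
Qed.

Lemma strongly_circular_circular (C : numClosedFieldType) (H : hilbertType C)
    (T : {linear H -> H}) : strongly_circular T -> circular T.
Proof.
by move=> [U [Uu _ _] UT] l l1; exists (U l); [apply: Uu|apply: UT].
Qed.

Lemma unitary_piso (R : realType) (H : hilbertType R[i]) (T U : {linear H -> H}) l :
  unitary U -> (forall x, U (T x) = l *: T (U x)) ->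
  exists W, piso T l id id U W.
Proof.
move=> [[W UW WU] Uin] UT; exists W; split=> // x y.
by rewrite -{1}(WU y) Uin.
Qed.

Section Assembly.
Variables (R : realType) (H : hilbertType R[i]).
Local Notation C := R[i].
Variables (T : {linear H -> H}) (k : nat) (p : 'I_k -> H -> H).
Hypotheses (rp : forall i, red T (p i)) (sp : forall x, \sum_i p i x = x).
Variables V W : 'I_k -> C -> H -> H.
Hypothesis VW : forall i l, nrm l = 1 -> piso T l (p i) (p i) (V i l) (W i l).
Hypothesis VM : forall i l m, nrm l = 1 -> nrm m = 1 ->
  forall x, V i (l * m) x = V i l (V i m x).
Hypothesis V_continuous : forall i (F : set_system C) l0 x, ProperFilter F ->
  F [set l | nrm l = 1] -> nrm l0 = 1 -> tends F (fun l => nrm (l - l0)) ->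
  tends F (fun l => nrm (V i l x - V i l0 x)).

(** [U l] is the orthogonal direct sum of the [V i l]. Cross terms vanish: [V j l] has values in the
    range of [p j], where [V i l] is 0 for [i] different from [j]. *)
Lemma assemble_strongly_circular : strongly_circular T.
Proof.
have va l (l1 : nrm l = 1) i : adj (V i l) (W i l) by case: (VW i l1).
have orth := decomposition_orth rp sp.
have /choice[U hU] l : exists U : {linear H -> H}, nrm l = 1 ->
    forall x, U x = \sum_i V i l x.
  (* Off the circle any linear map will do. *)
  have [l1|nl] := pselect (nrm l = 1); last by exists T.
  by have [U hU] := adj_linear (adj_sum (va l l1)); exists U.
have UW l (l1 : nrm l = 1) x : U l (\sum_i W i l x) = x.
  rewrite (hU _ l1) -[RHS]sp; apply: eq_bigr => i _.
  rewrite (adjv_sum _ _ _ (va _ l1 i)) (bigD1 i) //= big1 ?addr0.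
    by case: (VW i l1).
  move=> j ji; rewrite -(piso_dom (rp i) (VW i l1)).
  rewrite -(piso_dom_adj (rp j) (VW j l1)) orth 1?eq_sym //.
  exact: adj0 (va _ l1 i).
have WU l (l1 : nrm l = 1) x : \sum_i W i l (U l x) = x.
  rewrite (hU _ l1) -[RHS]sp; apply: eq_bigr => i _.
  rewrite (adjv_sum _ _ _ (adjC (va _ l1 i))) (bigD1 i) //= big1 ?addr0.
    by case: (VW i l1).
  move=> j ji; rewrite -(piso_cod_adj (rp i) (VW i l1)).
  rewrite -(piso_cod (rp j) (VW j l1)) orth 1?eq_sym //.
  exact: adj0 (adjC (va _ l1 i)).
exists U; last first.
  move=> l /unit_circleE l1 x; rewrite !(hU _ l1) linear_sum scaler_sumr.
  by apply: eq_bigr => i _; case: (VW i l1).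
split.
- move=> l /unit_circleE l1; split.
    by exists (fun x => \sum_i W i l x) => x; [apply: WU|apply: UW].
  move=> x y; rewrite {1}(hU _ l1) (adj_sum (va _ l1)); congr (_ x _).
  exact: WU.
- move=> l m /unit_circleE l1 /unit_circleE m1 x.
  have lm1 : nrm (l * m) = 1 by rewrite nrmM l1 m1 mulr1.
  rewrite (hU _ lm1) (hU _ l1) (hU _ m1); apply: eq_bigr => i _.
  rewrite (adjv_sum _ _ _ (va _ l1 i)) (bigD1 i) //= big1 ?addr0 ?VM //.
  move=> j ji; rewrite -(piso_dom (rp i) (VW i l1)).
  rewrite -(piso_cod (rp j) (VW j m1)) orth 1?eq_sym //.
  exact: adj0 (va _ l1 i).
move=> x; apply: continuous_within_circle => l0 l01 e e0.
have er : e = (complex.Re e)%:C%C by rewrite RRe_real ?gtr0_real.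
have e0' : 0 < complex.Re e by rewrite -ltcR -er.
have PF := circle_nbhs_proper l01.
have F1 : circle_nbhs l0 [set l | nrm l = 1].
  by apply: filterS (circle_nbhs_circle l0) => l /unit_circleE.
have tF : tends (circle_nbhs l0) (fun l => nrm (l - l0)).
  move=> d d0; have d0' : 0 < d%:C%C :> C by rewrite ltcR.
  by apply: filterS (circle_nbhs_dist l0 d0') => l /=; rewrite -nrmE ltcR.
move/unit_circleE in l01.
have tV := tends_sum (index_enum 'I_k) _ (fun i => V_continuous i x PF F1 l01 tF).
apply: filterS (filterI F1 (tV _ _ e0')) => l /= [l1 hl].
rewrite er -nrmE ltcR !hU // -sumrB; apply: le_lt_trans hl.
exact: ler_nrm_sum.
Qed.

End Assembly.

Theorem corollary3p5 (R : realType) (H : hilbertType R[i])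
    (H_separable : separable_space H)
    (Omega : set R[i]) (Omega_connected_open : connected_open Omega)
    (n : nat) (n_gt0 : (0 < n)%N)
    (T : {linear H -> H}) (T_bounded : bounded_operator T)
    (T_Bn : cowen_douglas Omega n T) :
  circular T <-> strongly_circular T.
Proof.
split; last exact: strongly_circular_circular.
move=> Tc; have [_ Tr Tspan Tdim] := T_Bn.
have [S TS] : exists S, adj T S.
  have [M hM] := T_bounded.
  (* The bound [M] is a complex number; as [M * |x|] dominates a norm, it may be replaced by its
     modulus. *)
  apply: (@bounded_adj _ _ T (nrm M)) => [a x y|x]; first exact: linearP.
  rewrite -lecR rmorphM /= !nrmE -[`|x| in leRHS]normr_id -normrM.
  by rewrite ger0_norm // (le_trans (normr_ge0 (T x))).
have kerE w : ker_sub_scalar T w = eigsp T w.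
  by apply/seteqP; split=> x /eqP; rewrite ?subr_eq0 => /eqP // xE;
     apply/eqP; rewrite subr_eq0; apply/eqP.
have surj w : Omega w -> forall x, exists y, T y - w *: y = x.
  move=> Ow x; have : range (sub_scalar T w) x by rewrite Tr.
  by move=> [y _ <-]; exists y.
have dimE w : Omega w -> has_dimension (eigsp T w) n.
  by move=> Ow; rewrite -kerE; apply: Tdim.
have span (L : set H) : closed_subspace L ->
    (forall w, Omega w -> eigsp T w `<=` L) -> forall x, L x.
  move=> [sL cL] hL x; apply: cL.
  have : closed_linear_span (\bigcup_(w in Omega) ker_sub_scalar T w) x.
    by rewrite Tspan.
  apply: closure_subset; apply: linear_span_sub => // y [w Ow].
  by rewrite kerE; apply: hL.
have circ l : nrm l = 1 -> exists U, exists W, piso T l id id U W.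
  move=> /unit_circleE /Tc [U Uu UT].
  by have [W UW] := unitary_piso Uu UT; exists U, W.
(* The decomposition starts from a nonzero vector; on the zero space every equation between vectors
   holds and [T] itself serves as the representation. *)
have [x0|Htriv] := pselect (exists x : H, x <> 0); last first.
  have H0 x : x = 0 :> H by apply: contrapT => hx; apply: Htriv; exists x.
  exists (fun=> T); last by move=> l _ x; rewrite [LHS]H0 [RHS]H0.
  split=> [l _|l m _ _ x|x].
  - split; last by move=> x y; rewrite [T x]H0 [x]H0 [T y]H0 [y]H0.
    by exists id => x; rewrite [LHS]H0 [RHS]H0.
  - by rewrite [LHS]H0 [RHS]H0.
  apply: continuous_within_circle => l0 l01 e e0.
  have PF := circle_nbhs_proper l01.
  by apply: filterS (circle_nbhs_circle l0) => l _ /=; rewrite subrr normr0.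
(* For empty [Omega] the spanning condition would put every vector into the orthogonal complement of
   the whole space. *)
have [w0 Ow0] : exists w, Omega w.
  apply: contrapT => nO; have [x hx] := x0; apply: hx.
  have /(_ x) Lx : forall x, orth [set: H] x.
    by apply: span; [apply: orth_closed|move=> w Ow; case: nO; exists w].
  by apply: inner_self_eq0; apply: Lx.
have [k [p [ip sp]]] :=
  irr_decomposition TS Omega_connected_open surj span dimE Ow0 x0.
have rp i : red T (p i) by case: (ip i).
have /choice[V hV] i := irr_representation TS Omega_connected_open surj span
  dimE Ow0 (ip i) (irr_circular TS Omega_connected_open surj span dimE Ow0 circ
    ip sp i).
have /choice[W hVW] := hV.
apply: (assemble_strongly_circular rp sp (V := V) (W := W)).
- by move=> i; case: (hVW i).
- by move=> i; case: (hVW i).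
- by move=> i; case: (hVW i).
Qed.
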